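(* Suppose that $D=\bigcup_{i=1}^kD_i\subset(\mathbb{C}^n,0)=:X$ is a germ of a free divisor. Let $f\colon X\to Y:=(\mathbb{C}^k,0)$ be the map whose $i$th component $f_i\in\mathcal{O}_X$, for $i=1,\dots,k$, is a reduced equation for $D_i$. Suppose that, for $j=1,\dots,k$, there exist vector fields $\varepsilon_j\in\Theta_X$ such that $$df_i(\varepsilon_j)=\delta_{i,j}\cdot f_i\quad\text{for } i=1,\dots,k.$$ Let $N:=V(y_1\cdots y_k)\subset Y$ be the normal crossing divisor, so that $D=f^{-1}(N)$. Let $E\subset Y$ be a divisor such that $N+E$ is free. Then, provided that no component of $f^{-1}(E)$ lies in $D$, $f^{-1}(N+E)=D+f^{-1}(E)$ is a free divisor.
   Context: All germs are complex analytic and all hypersurfaces (divisors) are assumed reduced; a sum of divisors denotes their union. $\Theta_X$ is the module of vector fields on $X$, $df_i(\varepsilon)=\varepsilon(f_i)$, $y_1,\dots,y_k$ are coordinates on $Y$, and $\delta_{i,j}$ is the Kronecker delta. A hypersurface germ $Z=V(h)$ ($h$ reduced) in a smooth germ $M$ is a free divisor if the $\mathcal{O}_M$-module $\mathrm{Der}(-\log Z)$ of vector fields $\xi$ on $M$ with $\xi(h)\in\langle h\rangle$ is free. *)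

(* Defs.v *)
From HB Require Import structures.
From mathcomp Require Import all_boot all_order all_algebra.
From mathcomp Require Import boolp reals complex mpoly.

Set Implicit Arguments.
Unset Strict Implicit.
Unset Printing Implicit Defensive.

Import Order.TTheory GRing.Theory Num.Theory.
Local Open Scope ring_scope.

(******************************************************************************)
(*  Germs at 0 of complex analytic functions, vector fields and subspaces     *)
(*                                                                            *)
(* The ring O_{K^n,0} is the ring K{x_1, ..., x_n} of power series that       *)
(* converge absolutely on some polydisc around 0. A germ of complex subspace  *)
(* of (K^n,0) is given by its ideal in this ring; accordingly inclusion of    *)
(* germs is reverse inclusion of ideals, the union of reduced germs is the    *)
(* intersection of their ideals, and so on. The empty germ, with the unit     *)
(* ideal, is allowed.                                                         *)
(*                                                                            *)
(*           fps K n == formal power series ring K[[x_1, ..., x_n]]           *)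
(*        convergent == the subring of convergent series                      *)
(*          germ K n == O_{K^n,0} = K{x_1, ..., x_n}                          *)
(*            gX K i == the i-th coordinate function                          *)
(*        gderiv i h == the partial derivative dh/dx_i                        *)
(*     mapgerm K n k == analytic map germs (K^n,0) -> (K^k,0)                 *)
(*       gcomp h f == the composite h o f, i.e. f^*(h), for f : mapgerm K n k *)
(*       'rV[germ K n]_n == vector fields, xi = \sum_i xi 0 i * d/dx_i        *)
(*          vapp xi h == xi(h)                                                *)
(*   logarithmic h xi == xi is in Der(-log V(h)), i.e. xi(h) is in (h)        *)
(*         gpreim f Z == f^{-1}(Z), with its reduced structure                *)
(******************************************************************************)

Section FPS.

Variables (K : numFieldType) (n : nat).

Record fps := FPS { fcoef :> 'X_{1..n} -> K }.

HB.instance Definition _ := [isNew for fcoef].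
HB.instance Definition _ := [Choice of fps by <:].

Implicit Types (p q : fps) (m : 'X_{1..n}).

Lemma fpsP p q : p =1 q -> p = q.
Proof. by move=> pq; apply/val_inj/funext. Qed.

Definition fps0 := FPS (fun=> 0).
Definition fps1 := FPS (fun m => (m == 0%MM)%:R).
Definition fpsN p := FPS (fun m => - p m).
Definition fpsD p q := FPS (fun m => p m + q m).
Definition fpsM p q := FPS (fun m =>
  \sum_(k : 'X_{1..n < (mdeg m).+1, (mdeg m).+1} | m == (k.1 + k.2)%MM)
    p k.1 * q k.2).

Let trunc d p : {mpoly K[n]} := \sum_(m : 'X_{1..n < d}) p m *: 'X_[m].

Let trE d p m : (mdeg m < d)%N -> (trunc d p)@_m = p m.
Proof. exact: mcoeff_mpoly. Qed.

Let sumE d (p q : 'X_{1..n} -> K) (p' q' : {mpoly K[n]}) m : (mdeg m < d)%N ->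
  (forall k, (mdeg k < d)%N -> p'@_k = p k) ->
  (forall k, (mdeg k < d)%N -> q'@_k = q k) ->
  \sum_(k : 'X_{1..n < d, d} | m == (k.1 + k.2)%MM) p k.1 * q k.2
    = (p' * q')@_m.
Proof.
move=> md hp hq; rewrite [RHS](mcoeff_poly_mul _ _ md).
by apply: eq_bigr => -[a b] _; rewrite hp ?hq ?bmdeg.
Qed.

Let mulE d p q (p' q' : {mpoly K[n]}) m : (mdeg m < d)%N ->
  (forall k, (mdeg k < d)%N -> p'@_k = p k) ->
  (forall k, (mdeg k < d)%N -> q'@_k = q k) -> fpsM p q m = (p' * q')@_m.
Proof.
move=> md hp hq; apply: sumE => // k km; [apply: hp | apply: hq];
by rewrite (leq_ltn_trans _ md).
Qed.

Lemma fpsM_coef d p q m : (mdeg m < d)%N ->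
  fpsM p q m =
    \sum_(k : 'X_{1..n < d, d} | m == (k.1 + k.2)%MM) p k.1 * q k.2.
Proof.
move=> md; rewrite (mulE md (trE p) (trE q)).
by rewrite (sumE md (trE p) (trE q)).
Qed.

Let fpsDA : associative fpsD.
Proof. by move=> p q r; apply: fpsP => m /=; rewrite addrA. Qed.
Let fpsDC : commutative fpsD.
Proof. by move=> p q; apply: fpsP => m /=; rewrite addrC. Qed.
Let fps0D : left_id fps0 fpsD.
Proof. by move=> p; apply: fpsP => m /=; rewrite add0r. Qed.
Let fpsND : left_inverse fps0 fpsN fpsD.
Proof. by move=> p; apply: fpsP => m /=; rewrite addNr. Qed.

HB.instance Definition _ := GRing.isZmodule.Build fps fpsDA fpsDC fps0D fpsND.

Let fpsMA : associative fpsM.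
Proof.
move=> p q r; apply: fpsP => m; pose d := (mdeg m).+1.
have tr2 a b k : (mdeg k < d)%N -> (trunc d a * trunc d b)@_k = fpsM a b k.
  by move=> kd; rewrite (mulE kd (trE a) (trE b)).
rewrite (mulE (ltnSn _) (trE p) (tr2 q r)).
by rewrite (mulE (ltnSn _) (tr2 p q) (trE r)) mulrA.
Qed.
Let fpsMC : commutative fpsM.
Proof.
move=> p q; apply: fpsP => m.
rewrite (mulE (ltnSn _) (trE p) (trE q)).
by rewrite (mulE (ltnSn _) (trE q) (trE p)) mulrC.
Qed.
Let fps1M : left_id fps1 fpsM.
Proof.
move=> p; apply: fpsP => m.
have tr1 k : (mdeg k < (mdeg m).+1)%N -> 1@_k = fps1 k.
  by move=> _; rewrite mcoeff1.
by rewrite (mulE (ltnSn _) tr1 (trE p)) mul1r trE.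
Qed.
Let fpsMDl : left_distributive fpsM fpsD.
Proof.
move=> p q r; apply: fpsP => m /=; rewrite -big_split /=.
by apply: eq_bigr => k _; rewrite mulrDl.
Qed.
Let fps1_neq0 : fps1 != fps0.
Proof.
by apply/eqP => /(congr1 (fun p : fps => p 0%MM)) /eqP; rewrite /= eqxx oner_eq0.
Qed.

HB.instance Definition _ :=
  GRing.Zmodule_isComNzRing.Build fps fpsMA fpsMC fps1M fpsMDl fps1_neq0.

Lemma fcoef0 m : (0 : fps) m = 0. Proof. by []. Qed.
Lemma fcoef1 m : (1 : fps) m = (m == 0%MM)%:R. Proof. by []. Qed.
Lemma fcoefN p m : (- p) m = - p m. Proof. by []. Qed.
Lemma fcoefD p q m : (p + q) m = p m + q m. Proof. by []. Qed.
Lemma fcoefM d p q m : (mdeg m < d)%N ->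
  (p * q) m = \sum_(k : 'X_{1..n < d, d} | m == (k.1 + k.2)%MM) p k.1 * q k.2.
Proof. exact: fpsM_coef. Qed.

Definition fpsX (i : 'I_n) := FPS (fun m => (m == U_(i)%MM)%:R).

Definition fderiv (i : 'I_n) p := FPS (fun m => p (m + U_(i))%MM *+ (m i).+1).

(* The partial sums, over the monomials of degree < d, of \sum_m |p_m| r^|m|. *)
Definition psum d (r : K) p :=
  \sum_(m : 'X_{1..n < d}) `|p m| * r ^+ mdeg m.

Definition convergent : {pred fps} := [pred p |
  `[< exists2 r : K, 0 < r & exists M : K, forall d, psum d r p <= M >]].

Lemma convergentP p :
  reflect (exists2 r : K, 0 < r & exists M : K, forall d, psum d r p <= M)
          (p \in convergent).
Proof. by rewrite inE; apply: asboolP. Qed.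

Lemma psum_ge0 d r p : 0 <= r -> 0 <= psum d r p.
Proof. by move=> r0; apply: sumr_ge0 => m _; rewrite mulr_ge0 ?exprn_ge0. Qed.

Lemma psum_le d r s p : 0 <= r -> r <= s -> psum d r p <= psum d s p.
Proof.
move=> r0 rs; apply: ler_sum => m _; apply: ler_wpM2l => //.
by rewrite lerXn2r ?nnegrE // (le_trans r0).
Qed.

Lemma psum0 d r : psum d r 0 = 0.
Proof. by rewrite /psum big1 // => m _; rewrite fcoef0 normr0 mul0r. Qed.

Lemma psumN d r p : psum d r (- p) = psum d r p.
Proof. by apply: eq_bigr => m _; rewrite fcoefN normrN. Qed.

Lemma psumD d r p q : 0 <= r -> psum d r (p + q) <= psum d r p + psum d r q.
Proof.
move=> r0; rewrite -big_split; apply: ler_sum => m _ /=.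
by rewrite -mulrDl ler_wpM2r ?exprn_ge0 ?fcoefD ?ler_normD.
Qed.

Lemma psum1 d r : psum d r 1 <= 1.
Proof.
case: d => [|d]; first by rewrite /psum big1 ?ler01 // => -[].
rewrite /psum (bigD1 bm0) // big1 /= => [|m].
  by rewrite eqxx normr1 mdeg0 expr0 mulr1 addr0.
by rewrite bmeqP /= => /negPf ->; rewrite normr0 mul0r.
Qed.

Lemma psumM d r p q : 0 <= r -> psum d r (p * q) <= psum d r p * psum d r q.
Proof.
move=> r0; pose F (a b : 'X_{1..n < d}) :=
  (`|p a| * r ^+ mdeg a) * (`|q b| * r ^+ mdeg b).
have F0 a b : 0 <= F a b by rewrite /F !mulr_ge0 ?exprn_ge0.
have -> : psum d r p * psum d r q = \sum_k F k.1 k.2.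
  by rewrite /psum big_distrlr /= pair_bigA.
apply: (@le_trans _ _ (\sum_(m : 'X_{1..n < d})
   \sum_(k : 'X_{1..n < d, d} | m == (k.1 + k.2)%MM :> 'X_{1..n}) F k.1 k.2)).
  rewrite /psum; apply: ler_sum => m _; rewrite (fcoefM _ _ (bmdeg m)).
  apply: (le_trans (ler_wpM2r (exprn_ge0 _ r0) (ler_norm_sum _ _ _))).
  rewrite mulr_suml; apply: ler_sum => -[a b] /= /eqP ->.
  by rewrite mdegD exprD normrM mulrACA.
under eq_bigr do rewrite big_mkcond.
rewrite exchange_big; apply: ler_sum => -[a b] _ /=.
rewrite -big_mkcond /=.
have [ab|ab] := ltnP (mdeg (a + b)%MM) d.
  rewrite (big_pred1 (BMultinom ab)) // => m; exact: bmeqP.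
by rewrite big1 // => m /eqP E; move: (bmdeg m); rewrite E ltnNge ab.
Qed.

Lemma convergent2P p q : p \in convergent -> q \in convergent ->
  exists2 r : K, 0 < r & exists M : K,
    0 <= M /\ forall d, psum d r p <= M /\ psum d r q <= M.
Proof.
move=> /convergentP[r r0 [M pM]] /convergentP[s s0 [N qN]].
have M0 : 0 <= M by apply: le_trans (pM 0%N); apply/psum_ge0/ltW.
have N0 : 0 <= N by apply: le_trans (qN 0%N); apply/psum_ge0/ltW.
have rs0 : 0 < r + s by rewrite addr_gt0.
have t0 : 0 < r * s / (r + s) by rewrite divr_gt0 ?mulr_gt0.
exists (r * s / (r + s)) => //; exists (M + N); split; first exact: addr_ge0.
move=> d; split.
  apply: (@le_trans _ _ M); last by rewrite lerDl.
  apply: le_trans (pM d); apply: psum_le; first exact: ltW.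
  by rewrite ler_pdivrMr // ler_pM2l // lerDr ltW.
apply: (@le_trans _ _ N); last by rewrite lerDr.
apply: le_trans (qN d); apply: psum_le; first exact: ltW.
by rewrite ler_pdivrMr // mulrC ler_pM2l // lerDl ltW.
Qed.

Lemma convergent_subring : subring_closed convergent.
Proof.
split=> [|p q pc qc|p q pc qc].
- apply/convergentP; exists 1; first exact: ltr01.
  by exists 1 => d; apply: psum1.
- have [r r0 [M [M0 pqM]]] := convergent2P pc qc.
  apply/convergentP; exists r => //; exists (M + M) => d.
  have [pM qM] := pqM d; apply: (le_trans (psumD _ _ _ (ltW r0))).
  by rewrite psumN lerD.
- have [r r0 [M [M0 pqM]]] := convergent2P pc qc.
  apply/convergentP; exists r => //; exists (M * M) => d.
  have [pM qM] := pqM d; apply: (le_trans (psumM _ _ _ (ltW r0))).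
  by apply: ler_pM => //; apply/psum_ge0/ltW.
Qed.

HB.instance Definition _ :=
  GRing.isSubringClosed.Build fps convergent convergent_subring.

Record germ := Germ { gval :> fps; _ : gval \in convergent }.

HB.instance Definition _ := [isSub for gval].
HB.instance Definition _ := [Choice of germ by <:].
HB.instance Definition _ := [SubChoice_isSubComNzRing of germ by <:].

End FPS.

Section GermTheory.

Variables (K : numFieldType) (n : nat).
Implicit Types (p : fps K n) (h : germ K n).

Lemma ler_sum_inj (A B : finType) (e : A -> B) (F : B -> K) :
  injective e -> (forall b, 0 <= F b) -> \sum_a F (e a) <= \sum_b F b.
Proof.
move=> e_inj F0.
have <- : \sum_(b in e @: setT) F b = \sum_a F (e a).
  by rewrite big_imset //=; [apply: eq_bigl => a; rewrite inE | move=> ? ? _ _ /e_inj].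
rewrite [leRHS](bigID (mem (e @: setT))) /= lerDl.
by apply: sumr_ge0.
Qed.

Lemma convergentX i : fpsX K i \in @convergent K n.
Proof.
apply/convergentP; exists 1; first exact: ltr01.
exists 1 => d; rewrite /psum.
have [d1|d1] := ltnP (mdeg (U_(i)%MM : 'X_{1..n})) d.
  rewrite (bigD1 (BMultinom d1)) // big1 /= => [|m].
    by rewrite eqxx normr1 expr1n mulr1 addr0.
  by rewrite bmeqP /= => /negPf ->; rewrite normr0 mul0r.
rewrite big1 ?ler01 // => m _ /=; case: eqP => [E|_].
  by move: (bmdeg m); rewrite E ltnNge d1.
by rewrite normr0 mul0r.
Qed.

Definition gX i : germ K n := Germ (convergentX i).

Lemma convergent_deriv i p : p \in @convergent K n ->
  fderiv i p \in @convergent K n.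
Proof.
move=> /convergentP[r r0 [M pM]]; apply/convergentP.
have r20 : 0 < r / 2%:R by rewrite divr_gt0 // ltr0n.
exists (r / 2%:R) => //; exists (M / r) => d.
rewrite ler_pdivlMr //; apply: le_trans (pM d.+1).
have eP (m : 'X_{1..n < d}) : (mdeg (m + U_(i))%MM < d.+1)%N.
  by rewrite mdegD mdeg1 addn1 ltnS bmdeg.
pose e m := BMultinom (eP m).
have e_inj : injective e.
  by move=> a b /(congr1 val) /= /addIm ab; apply: val_inj.
rewrite /psum; apply: le_trans (ler_sum_inj e_inj _) => [|b]; last first.
  by rewrite mulr_ge0 ?exprn_ge0 // ltW.
rewrite mulr_suml; apply: ler_sum => m _ /=.
rewrite normrMn mdegD mdeg1 addn1 exprSr mulrA.
apply: ler_wpM2r; first exact: ltW.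
rewrite mulrnAl -mulrnAr; apply: ler_wpM2l => //.
rewrite expr_div_n -mulr_natr mulrAC ler_pdivrMr ?exprn_gt0 ?ltr0n //.
apply: ler_wpM2l; first by rewrite exprn_ge0 // ltW.
rewrite -natrX ler_nat.
apply: (@leq_trans (mdeg m).+1); last exact: ltn_expl.
by rewrite ltnS mdegE (bigD1 i) //= leq_addr.
Qed.

Definition gderiv i h : germ K n := Germ (convergent_deriv i (valP h)).

End GermTheory.

Arguments gX K {n} i.

Section Composition.

Variables (K : numFieldType) (n k : nat).
Implicit Types (h : fps K k) (f : 'I_k -> fps K n).

(* If all f_i vanish at 0, then \prod_i f_i^(a_i) has order at least |a|, so   *)
(* that this is the full sum of the h_a * \prod_i f_i^(a_i).                   *)
Definition fcomp h f := FPS (fun m : 'X_{1..n} =>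
  \sum_(a : 'X_{1..k < (mdeg m).+1}) h a * (\prod_i f i ^+ a i) m).

Lemma psumX d (r : K) (p : fps K n) e : 0 <= r -> psum d r (p ^+ e) <= psum d r p ^+ e.
Proof.
move=> r0; elim: e => [|e IH]; first by rewrite !expr0 psum1.
rewrite !exprS; apply: (le_trans (psumM _ _ _ r0)).
by rewrite ler_wpM2l ?psum_ge0.
Qed.

Lemma psum_prod d (r : K) (I : finType) (g : I -> fps K n) : 0 <= r ->
  psum d r (\prod_i g i) <= \prod_i psum d r (g i).
Proof.
move=> r0; elim/big_rec2: _ => [|i y x _ IH]; first exact: psum1.
by apply: (le_trans (psumM _ _ _ r0)); rewrite ler_wpM2l ?psum_ge0.
Qed.

Lemma psum_comp d (r s : K) h f : 0 <= r -> (forall i, psum d r (f i) <= s) ->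
  psum d r (fcomp h f) <= psum d s h.
Proof.
move=> r0 fs; pose F (a : 'X_{1..k}) : fps K n := \prod_i f i ^+ a i.
apply: (@le_trans _ _ (\sum_(m : 'X_{1..n < d}) \sum_(a : 'X_{1..k < d})
   `|h a| * (`|F a m| * r ^+ mdeg m))).
  apply: ler_sum => m _ /=.
  apply: (le_trans (ler_wpM2r (exprn_ge0 _ r0) (ler_norm_sum _ _ _))).
  rewrite mulr_suml; apply: (@le_trans _ _
    (\sum_(a : 'X_{1..k < (mdeg m).+1}) `|h a| * (`|F a m| * r ^+ mdeg m))).
    by apply: ler_sum => a _; rewrite normrM -mulrA.
  have eP (a : 'X_{1..k < (mdeg m).+1}) : (mdeg a < d)%N.
    exact: leq_trans (bmdeg a) (bmdeg m).
  have e_inj : injective (fun a => BMultinom (eP a)).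
    by move=> a b /(congr1 val) /= ab; apply: val_inj.
  apply: (ler_sum_inj (F := fun a : 'X_{1..k < d} =>
    `|h a| * (`|F a m| * r ^+ mdeg m)) e_inj) => a.
  by rewrite !mulr_ge0 ?exprn_ge0.
rewrite exchange_big; apply: ler_sum => a _ /=.
rewrite -mulr_sumr ler_wpM2l //.
apply: le_trans (psum_prod d _ r0) _.
rewrite mdegE -prodrXr; apply: ler_prod => i _; rewrite psum_ge0 //=.
apply: le_trans (psumX _ _ _ r0) _.
by rewrite lerXn2r ?nnegrE ?psum_ge0 // (le_trans _ (fs i)) ?psum_ge0.
Qed.

Lemma psum_small d (r t : K) (p : fps K n) : p 0%MM = 0 -> 0 <= r -> 0 <= t ->
  t <= 1 -> psum d (r * t) p <= psum d r p * t.
Proof.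
move=> p0 r0 t0 t1; rewrite mulr_suml; apply: ler_sum => m _.
have [->|m0] := eqVneq (m : 'X_{1..n}) 0%MM.
  by rewrite p0 normr0 !mul0r.
rewrite exprMn mulrA ler_wpM2l ?mulr_ge0 ?exprn_ge0 //.
rewrite -mdeg_eq0 in m0; case: (mdeg m) m0 => // e _.
by rewrite exprS ler_piMr // exprn_ile1.
Qed.

Lemma convergent_comp h f : h \in @convergent K k ->
  (forall i, f i \in @convergent K n) -> (forall i, f i 0%MM = 0) ->
  fcomp h f \in @convergent K n.
Proof.
move=> /convergentP[s s0 [N hN]] fc f0.
have [r r0 [M M0 fM]] : exists2 r : K, 0 < r & exists2 M : K, 0 <= M &
    forall i d, psum d r (f i) <= M.
  have /choice[ru ruP] i : exists u : K * K,
      0 < u.1 /\ forall d, psum d u.1 (f i) <= u.2.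
    by have /convergentP[r r0 [M fM]] := fc i; exists (r, M).
  have M0 i : 0 <= (ru i).2.
    have [r0 fM] := ruP i.
    by apply: le_trans (fM 0%N); apply/psum_ge0/ltW.
  have S0 (P : pred 'I_k) : 0 <= \sum_(i | P i) (ru i).1^-1.
    by apply: sumr_ge0 => i _; rewrite invr_ge0 ltW //; case: (ruP i).
  have q0 : 0 < 1 + \sum_i (ru i).1^-1.
    by rewrite (lt_le_trans ltr01) // lerDl S0.
  exists (1 + \sum_i (ru i).1^-1)^-1; first by rewrite invr_gt0.
  exists (\sum_i (ru i).2) => [|i d]; first exact: sumr_ge0.
  have [ri0 fM] := ruP i.
  apply: (@le_trans _ _ (ru i).2).
    apply: le_trans (fM d); apply: psum_le; first by rewrite invr_ge0 ltW.
    rewrite -[leRHS]invrK lef_pV2 ?posrE ?invr_gt0 //.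
    by rewrite (bigD1 i) //= addrCA lerDl addr_ge0 ?S0 ?ler01.
  by rewrite (bigD1 i) //= lerDl sumr_ge0.
have sM : 0 < s + M by rewrite ltr_pwDl.
pose t := s / (s + M).
have t0 : 0 < t by rewrite divr_gt0.
have t1 : t <= 1 by rewrite ler_pdivrMr // mul1r lerDl.
apply/convergentP; exists (r * t); first exact: mulr_gt0.
exists N => d; apply: le_trans (hN d); apply: psum_comp => [|i].
  exact/ltW/mulr_gt0.
apply: (le_trans (psum_small _ (f0 i) (ltW r0) (ltW t0) t1)).
apply: (@le_trans _ _ (M * t)); first by rewrite ler_wpM2r // ltW.
by rewrite mulrA ler_pdivrMr // mulrC ler_wpM2l ?(ltW s0) // lerDr ltW.
Qed.

Record mapgerm := MapGerm {
  mapcomp :> 'I_k -> germ K n;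
  mapcomp0 : forall i, mapcomp i 0%MM = 0 }.

Definition gcomp (h : germ K k) (f : mapgerm) : germ K n :=
  Germ (convergent_comp (valP h) (fun i => valP (f i)) (mapcomp0 f)).

End Composition.

(* [M] is free of finite rank. Finiteness is no restriction for submodules of *)
(* the module of vector fields, the ring of germs being noetherian.           *)
Definition free_submod (A : nzRingType) (V : lmodType A) (M : V -> Prop) : Prop :=
  exists (r : nat) (b : 'I_r -> V),
    (forall j, M (b j)) /\
    (forall v, M v -> exists! c : 'rV[A]_r, v = \sum_j c 0 j *: b j).

Section Subgerms.

Variables (K : numFieldType) (n : nat).

(* Below, Z, P : {pred germ K n} stand for germs of complex subspaces of      *)
(* (K^n,0), given by their ideals.                                            *)
Implicit Types (Z P Q : {pred germ K n}) (h a : germ K n).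

(* V(h) *)
Definition zeros h : {pred germ K n} := [pred a | `[< exists c, a = c * h >]].

Definition radical Z : {pred germ K n} :=
  [pred a | `[< exists e : nat, a ^+ e \in Z >]].

(* h generates the ideal of Z, and O/(h) has no nilpotent elements. *)
Definition reduced_equation h Z : Prop :=
  [/\ h != 0, radical (zeros h) =i zeros h & Z =i zeros h].

Definition hypersurface Z : Prop := exists h, reduced_equation h Z.

Definition gunion Z Q : {pred germ K n} := [predI Z & Q].

Definition gbigunion (k : nat) (Z : 'I_k -> {pred germ K n}) :
  {pred germ K n} := [pred a | [forall i, a \in Z i]].

Definition prime_ideal P : Prop := idealr_closed P /\ prime_idealr_closed P.

(* Irreducible components correspond to minimal primes over the ideal. *)
Definition component P Z : Prop :=
  [/\ prime_ideal P, {subset Z <= P} &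
      forall Q, prime_ideal Q -> {subset Z <= Q} -> {subset Q <= P} ->
                {subset P <= Q}].

Definition lies_in P Z : Prop := {subset Z <= P}.

Definition vapp (xi : 'rV[germ K n]_n) h : germ K n :=
  \sum_i xi 0 i * gderiv i h.

Definition logarithmic h (xi : 'rV[germ K n]_n) : Prop :=
  vapp xi h \in zeros h.

Definition free_divisor Z : Prop :=
  exists2 h, reduced_equation h Z & free_submod (logarithmic h).

End Subgerms.

Definition normal_crossing (K : numFieldType) (k : nat) : {pred germ K k} :=
  zeros (\prod_i gX K i).

(* The preimage f^{-1}(Z), with its reduced structure: the radical of the     *)
(* ideal generated by f^*(Z).                                                 *)
Definition gpreim (K : numFieldType) (n k : nat) (f : mapgerm K n k)
    (Z : {pred germ K k}) : {pred germ K n} :=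
  radical [pred a | `[< exists (r : nat) (c : 'I_r -> germ K n)
                               (g : 'I_r -> germ K k),
    (forall j, g j \in Z) /\ a = \sum_j c j * gcomp (g j) f >]].

Arguments normal_crossing K k : clear implicits.

(* Main.v *)
Require Import Defs.
From HB Require Import structures.
From mathcomp Require Import all_boot all_order all_algebra.
From mathcomp Require Import boolp reals complex mpoly ring.

Set Implicit Arguments.
Unset Strict Implicit.
Unset Printing Implicit Defensive.

Import Order.TTheory GRing.Theory Num.Theory.
Local Open Scope ring_scope.

(** Write y_1, ..., y_k for the coordinates of the target, g for an equation of E,
    G for its pullback g o f, and h for an equation of the free divisor D. The
    fields eps_i lift the Euler fields y_i d/dy_i: the derivative of g o f along
    eps_i is (y_i dg/dy_i) o f. A field tangent to N + E has the form
    sum_i a_i y_i d/dy_i and lifts to sum_i (a_i o f) eps_i, which is tangent to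
    D and to V(G). On the other hand any field xi tangent to D has
    xi(f_i) = phi_i f_i, so that xi - sum_i phi_i eps_i kills every f_i and is
    tangent to V(G) as well. Thus, starting from a basis of the fields tangent to
    D and replacing its components along the eps_i by combinations of lifts, one
    obtains n fields tangent to D + V(G). Saito's criterion computes the
    determinants: that of the old basis is h, that of a basis for N + E is
    y_1 ... y_k g, hence its matrix on the Euler fields has determinant g, and
    the new fields have determinant h * G, up to units (pullback_free). By Saito's
    criterion again they form a basis, provided that h * G is a reduced equation
    of D + V(G).

    The last point is where the hypothesis on components enters: off D the map
    f is a submersion, so that G is reduced there, and no component of V(G) lies
    in D. To make this precise, and to prove Saito's criterion, one needs the
    primes of height one of the ring of germs. They are produced by Weierstrass
    division (division_exists, a Neumann series), which embeds the germs modulo G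
    in a quotient of a polynomial ring in one variable over a field. This gives,
    for d not in (G), a prime P which is minimal over G, contains the
    annihilator of d modulo G, and becomes principal after localization
    (exists_associated_prime). At such a prime a reduced germ has a nonvanishing
    derivative (reduced_smooth_point). This applies to g at the contraction of P
    along f because that contraction has height one as well, by a Jacobian
    criterion (jacobian_principal, smooth_pullback). It follows that G is reduced
    (pull_radical) and that h is regular modulo G (pull_coprime). *)

(** * Power series up to high order *)

Section Order.

Variables (K : numFieldType) (n : nat).
Implicit Types (p q : fps K n) (m : 'X_{1..n}) (P Q : {mpoly K[n]}).

(** The powers of the maximal ideal. They intersect in 0, so that an identity
    between operations continuous for the order need only be checked on
    polynomials. *)
Definition ordge d p := forall m, (mdeg m < d)%N -> p m = 0.

Definition fpoly P : fps K n := FPS (fun m => P@_m).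

Definition fconst (c : K) : fps K n := FPS (fun m => c * (m == 0%MM)%:R).

Definition trunc d p : {mpoly K[n]} := \sum_(m : 'X_{1..n < d}) p m *: 'X_[m].

Lemma fpolyB : {morph fpoly : P Q / P - Q}.
Proof. by move=> P Q; apply: fpsP => m /=; rewrite mcoeffB. Qed.

Lemma fpolyM : {morph fpoly : P Q / P * Q}.
Proof.
move=> P Q; apply: fpsP => m; rewrite (fcoefM _ _ (ltnSn (mdeg m))) /=.
exact: (mcoeff_poly_mul _ _ (ltnSn _)).
Qed.

Lemma fpoly1 : fpoly 1 = 1.
Proof. by apply: fpsP => m /=; rewrite mcoeff1. Qed.

HB.instance Definition _ :=
  GRing.isZmodMorphism.Build {mpoly K[n]} (fps K n) fpoly fpolyB.
HB.instance Definition _ :=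
  GRing.isMonoidMorphism.Build {mpoly K[n]} (fps K n) fpoly (fpoly1, fpolyM).

Lemma fconstB : {morph fconst : a b / a - b}.
Proof. by move=> a b; apply: fpsP => m /=; rewrite mulrBl. Qed.

Lemma fconstE c : fconst c = fpoly c%:MP.
Proof. by apply: fpsP => m /=; rewrite mcoeffC eq_sym. Qed.

Lemma fconst1 : fconst 1 = 1.
Proof. by apply: fpsP => m /=; rewrite mul1r. Qed.

Lemma fconstM : {morph fconst : a b / a * b}.
Proof. by move=> a b; rewrite !fconstE mpolyCM rmorphM. Qed.

HB.instance Definition _ :=
  GRing.isZmodMorphism.Build K (fps K n) fconst fconstB.
HB.instance Definition _ :=
  GRing.isMonoidMorphism.Build K (fps K n) fconst (fconst1, fconstM).

Lemma ordgeD d p q : ordge d p -> ordge d q -> ordge d (p + q).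
Proof. by move=> pd qd m md; rewrite fcoefD pd ?qd ?addr0. Qed.

Lemma ordgeN d p : ordge d p -> ordge d (- p).
Proof. by move=> pd m md; rewrite fcoefN pd ?oppr0. Qed.

Lemma ordgeB d p q : ordge d p -> ordge d q -> ordge d (p - q).
Proof. by move=> pd qd; apply/ordgeD/ordgeN. Qed.

Lemma ordge_sum d (I : finType) (F : I -> fps K n) :
  (forall i, ordge d (F i)) -> ordge d (\sum_i F i).
Proof. by move=> Fd; elim/big_ind: _ => //; apply: ordgeD. Qed.

Lemma ordgeW d e p : (e <= d)%N -> ordge d p -> ordge e p.
Proof. by move=> ed pd m me; apply: pd; apply: leq_trans ed. Qed.

Lemma ordgeM d e p q : ordge d p -> ordge e q -> ordge (d + e) (p * q).
Proof.
move=> pd qe m md; rewrite (fcoefM _ _ (ltnSn (mdeg m))) big1 // => -[a b] /=.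
move=> /eqP E; have {}md : (mdeg a + mdeg b < d + e)%N by rewrite -mdegD -E.
have [ad|ad] := ltnP (mdeg a) d; first by rewrite pd ?mul0r.
rewrite qe ?mulr0 // ltnNge; apply/negP => be; move: md.
by rewrite ltnNge leq_add.
Qed.

Lemma ordgeMl d p q : ordge d q -> ordge d (p * q).
Proof. by move=> qd; rewrite -[d]add0n; apply: ordgeM. Qed.

Lemma ordgeMr d p q : ordge d p -> ordge d (p * q).
Proof. by rewrite mulrC; apply: ordgeMl. Qed.

Lemma ordgeX d p e : ordge d p -> ordge (d * e) (p ^+ e).
Proof.
move=> pd; elim: e => [|e IH]; first by rewrite muln0.
by rewrite mulnS exprS; apply: ordgeM.
Qed.

Lemma ordge_eq0 p : (forall d, ordge d p) -> p = 0.
Proof. by move=> pd; apply: fpsP => m; rewrite (pd (mdeg m).+1). Qed.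

Lemma trunc_coef d p m : (mdeg m < d)%N -> (trunc d p)@_m = p m.
Proof. exact: mcoeff_mpoly. Qed.

Lemma ordge_trunc d p : ordge d (p - fpoly (trunc d p)).
Proof. by move=> m md; rewrite fcoefD fcoefN /= trunc_coef ?subrr. Qed.

Lemma ordge_fpoly d p : exists P, exists2 q : fps K n, p = fpoly P + q & ordge d q.
Proof.
exists (trunc d p), (p - fpoly (trunc d p)); last exact: ordge_trunc.
by rewrite addrC subrK.
Qed.

Lemma fcoefM0 p q : (p * q) 0%MM = p 0%MM * q 0%MM.
Proof.
have [P [p' -> Hp]] := ordge_fpoly 1 p; have [Q [q' -> Hq]] := ordge_fpoly 1 q.
have H0 r : ordge 1 r -> r 0%MM = 0 by move=> r1; apply: r1; rewrite mdeg0.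
rewrite mulrDl !mulrDr !fcoefD (H0 _ (ordgeMl (fpoly P) Hq)).
rewrite (H0 _ (ordgeMr _ Hp)) (H0 _ (ordgeMr _ Hp)) (H0 _ Hp) (H0 _ Hq).
rewrite !addr0 ?mulr0 ?mul0r ?addr0.
by rewrite -[RHS]/(mcoeff 0%MM P * mcoeff 0%MM Q) -!rmorphM.
Qed.

Lemma ordge1P p : ordge 1 p <-> p 0%MM = 0.
Proof.
split=> [p1|p0 m]; first by apply: p1; rewrite mdeg0.
by rewrite ltnS leqn0 mdeg_eq0 => /eqP ->.
Qed.

(** The product of the lowest homogeneous parts of two nonzero series is the
    lowest homogeneous part of their product. *)
Lemma fps_domain p q : p * q = 0 -> p = 0 \/ q = 0.
Proof.
move=> pq0; apply: contrapT => /not_orP[p0 q0].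
have low r : r <> 0 -> exists d, ordge d r /\ exists2 m, mdeg m = d & r m != 0.
  move=> r0; have ex : exists d, `[< exists2 m, mdeg m = d & r m != 0 >].
    apply: contrapT => H; apply: r0; apply: fpsP => m; apply/eqP.
    apply: contrapT => /negP rm; apply: H; exists (mdeg m); apply/asboolP.
    by exists m.
  exists (ex_minn ex); case: ex_minnP => d /asboolP Hd dmin; split=> // m md.
  apply/eqP; apply: contrapT => /negP rm.
  have : (d <= mdeg m)%N by apply: dmin; apply/asboolP; exists m.
  by rewrite leqNgt md.
have {p0}[d [pd [a ad pa]]] := low p p0.
have {q0}[e [qe [b be qb]]] := low q q0.
pose P := trunc d.+1 p; pose Q := trunc e.+1 q.
have P0 : P != 0.
  apply: contra pa => /eqP E.
  by rewrite -(@trunc_coef d.+1) ?ad // -/P E mcoeff0.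
have Q0 : Q != 0.
  apply: contra qb => /eqP E.
  by rewrite -(@trunc_coef e.+1) ?be // -/Q E mcoeff0.
have pqE : ordge (d + e).+1 (fpoly (P * Q)).
  rewrite rmorphM /=.
  have -> : fpoly P * fpoly Q =
     - ((p - fpoly P) * q + fpoly P * (q - fpoly Q)).
    by rewrite mulrBl mulrBr pq0 sub0r addrA addNr add0r opprK.
  have Pd : ordge d (fpoly P).
    rewrite -[fpoly P](subKr p); apply: ordgeB => //.
    by apply: (ordgeW (leqnSn d)); apply: ordge_trunc.
  apply/ordgeN/ordgeD; first by rewrite -addSn; apply/ordgeM/qe/ordge_trunc.
  by rewrite -addnS; apply/ordgeM/ordge_trunc.
have PQ0 : P * Q != 0 by rewrite mulf_neq0.
have dP c (r : fps K n) m : (c < mdeg m)%N -> (trunc c.+1 r)@_m = 0.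
  move=> cm; rewrite /trunc raddf_sum /= big1 // => x _.
  rewrite mcoeffZ mcoeffX; case: eqP => [E|]; last by rewrite mulr0.
  by move: (bmdeg x); rewrite E ltnS leqNgt cm.
have := PQ0; rewrite -mleadc_eq0 => /negP; apply; apply/eqP.
apply: pqE; rewrite mleadM // mdegD ltnS leq_add //.
  rewrite leqNgt; apply/negP => /(dP d p) /eqP.
  by rewrite mleadc_eq0 (negPf P0).
rewrite leqNgt; apply/negP => /(dP e q) /eqP.
by rewrite mleadc_eq0 (negPf Q0).
Qed.

(** * Derivations *)

Lemma fderivB i : {morph (@fderiv K n i) : p q / p - q}.
Proof. by move=> p q; apply: fpsP => m /=; rewrite mulrnBl. Qed.

HB.instance Definition _ i :=
  GRing.isZmodMorphism.Build (fps K n) (fps K n) (fderiv i) (fderivB i).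

Lemma fderiv_fpoly i P : fderiv i (fpoly P) = fpoly (mderiv i P).
Proof. by apply: fpsP => m /=; rewrite mcoeff_deriv. Qed.

Lemma ordge_deriv d i p : ordge d.+1 p -> ordge d (fderiv i p).
Proof.
by move=> pd m md /=; rewrite pd ?mul0rn // mdegD mdeg1 addn1 ltnS.
Qed.

Lemma fderivM i p q : fderiv i (p * q) = fderiv i p * q + p * fderiv i q.
Proof.
apply/eqP; rewrite -subr_eq0; apply/eqP/ordge_eq0 => d.
have [P [p' -> Hp]] := ordge_fpoly d.+1 p.
have [Q [q' -> Hq]] := ordge_fpoly d.+1 q.
have := ordge_deriv i (ordgeMl (fpoly P) Hq).
have := ordge_deriv i (ordgeMr (fpoly Q + q') Hp).
have Hp' := ordge_deriv i Hp; have Hq' := ordge_deriv i Hq.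
have {}Hp := ordgeW (leqnSn _) Hp; have {}Hq := ordgeW (leqnSn _) Hq.
rewrite [X in fderiv i X - _]mulrDl [fpoly P * (_ + _)]mulrDr -rmorphM.
rewrite !raddfD /= => H1 H2; rewrite fderiv_fpoly mderivM rmorphD !rmorphM /=.
rewrite -!fderiv_fpoly; set A := fderiv i (fpoly P); set B := fderiv i (fpoly Q).
set U := fderiv i (_ * q') in H2 *; set V := fderiv i (p' * _) in H1 *.
have -> : A * fpoly Q + fpoly P * B + U + V
    + (- ((A + fderiv i p') * (fpoly Q + q'))
       - (fpoly P + p') * (B + fderiv i q'))
  = U + V - (A * q' + fderiv i p' * (fpoly Q + q')
             + (fpoly P * fderiv i q' + p' * (B + fderiv i q'))).
  by ring.
apply: ordgeB; first exact: ordgeD.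
apply: ordgeD; apply: ordgeD.
- exact: ordgeMl.
- exact: ordgeMr.
- exact: ordgeMl.
- exact: ordgeMr.
Qed.

End Order.

Section FConst.
Variables (K : numFieldType) (n : nat).
Implicit Types (p q : fps K n).

Lemma fconst_mul c p m : (fconst n c * p) m = c * p m.
Proof.
have [P [q -> Hq]] := ordge_fpoly (mdeg m).+1 p.
rewrite mulrDr !fcoefD (ordgeMl _ Hq) // (Hq m) // !addr0.
by rewrite fconstE -rmorphM /= mcoeffCM.
Qed.

Lemma fcoef_sum m (I : Type) (r : seq I) (Q : pred I) (F : I -> fps K n) :
  (\sum_(i <- r | Q i) F i) m = \sum_(i <- r | Q i) F i m.
Proof. by elim/big_rec2: _ => // i y x _ <-. Qed.

Lemma subUU (i : 'I_n) : (U_(i) - U_(i) = 0)%MM.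
Proof. by apply/mnmP => j; rewrite mnmBE mnm0E subnn. Qed.

Lemma fpsXE i : fpsX K i = fpoly ('X_i : {mpoly K[n]}).
Proof. by apply: fpsP => m /=; rewrite mcoeffX eq_sym. Qed.

Lemma fderiv_const i (c : K) : fderiv i (fconst n c) = 0.
Proof. by rewrite fconstE fderiv_fpoly mderivC raddf0. Qed.

Lemma fderivX i j : fderiv i (fpsX K j) = ((i == j)%:R : fps K n).
Proof.
rewrite fpsXE fderiv_fpoly mderivX mnm1E eq_sym; case: eqP => [->|_].
  by rewrite subUU mpolyX0 scale1r rmorph1.
by rewrite scale0r raddf0.
Qed.

End FConst.

(** * Composition of series *)

Section Composition.

Variables (K : numFieldType) (n k : nat) (f : 'I_k -> fps K n).
Hypothesis f0 : forall i, f i 0%MM = 0.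
Implicit Types (h : fps K k).

(** Each f i vanishes at 0. This is why a composite depends, up to a given
    order, on finitely many coefficients only. *)
Lemma ordge_monomial a : ordge (mdeg a) (\prod_i f i ^+ a i).
Proof.
rewrite mdegE; elim/big_rec2: _ => [|i p d _ IH]; first by [].
apply: ordgeM IH; rewrite -{1}[a i]mul1n.
by apply: ordgeX; apply/ordge1P.
Qed.

Lemma fcompB : {morph (fun h => fcomp h f) : g h / g - h}.
Proof.
move=> g h; apply: fpsP => m /=; rewrite -sumrB; apply: eq_bigr => a _.
by rewrite mulrBl.
Qed.

(** With its second argument fixed, fcomp distributes over sums. *)
Definition fpull h := fcomp h f.

HB.instance Definition _ :=
  GRing.isZmodMorphism.Build (fps K k) (fps K n) fpull fcompB.

Lemma fcompD g h : fcomp (g + h) f = fcomp g f + fcomp h f.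
Proof. exact: (raddfD fpull). Qed.

Lemma ordge_comp d h : ordge d h -> ordge d (fcomp h f).
Proof.
move=> hd m md /=; rewrite big1 // => a _.
by rewrite hd ?mul0r // (leq_trans (bmdeg a)).
Qed.

Lemma fcomp_fpoly P : fcomp (fpoly P) f = mmap (@fconst K n) f P.
Proof.
rewrite -/(fpull _) /mmap {1}[P]mpolyE !raddf_sum; apply: eq_bigr => a _ /=.
apply: fpsP => m; rewrite fconst_mul /mmap1 /=.
rewrite /fpull /=; have [am|ma] := leqP (mdeg a) (mdeg m).
  have am' : (mdeg a < (mdeg m).+1)%N by [].
  rewrite (bigD1 (BMultinom am')) //= [X in _ + X]big1 ?addr0 => [|b].
    by rewrite mcoeffZ mcoeffX eqxx mulr1.
  rewrite bmeqP /= => ba.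
  by rewrite mcoeffZ mcoeffX eq_sym (negPf ba) mulr0 mul0r.
rewrite (ordge_monomial ma) mulr0 big1 // => b _.
rewrite mcoeffZ mcoeffX; case: eqP => [E|_]; last by rewrite mulr0 mul0r.
by move: (bmdeg b); rewrite -E ltnS leqNgt ma.
Qed.

Lemma fcompM g h : fcomp (g * h) f = fcomp g f * fcomp h f.
Proof.
apply/eqP; rewrite -subr_eq0; apply/eqP/ordge_eq0 => d.
have [P [p -> Hp]] := ordge_fpoly d g; have [Q [q -> Hq]] := ordge_fpoly d h.
have Hp' := ordge_comp Hp; have Hq' := ordge_comp Hq.
have -> : (fpoly P + p) * (fpoly Q + q)
    = fpoly (P * Q) + (fpoly P * q + p * (fpoly Q + q)).
  by rewrite rmorphM /=; ring.
rewrite !fcompD !fcomp_fpoly rmorphM /=.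
set A := mmap _ _ P; set B := mmap _ _ Q.
set C := fcomp (_ * _) f; set D := fcomp (_ * _) f.
have HC : ordge d C by apply/ordge_comp/ordgeMl.
have HD : ordge d D by apply/ordge_comp/ordgeMr.
have -> : A * B + (C + D) - (A + fcomp p f) * (B + fcomp q f)
  = (C + D) - (A * fcomp q f + fcomp p f * (B + fcomp q f)) by ring.
by apply: ordgeB; apply: ordgeD => //; [apply: ordgeMl | apply: ordgeMr].
Qed.

Lemma fcomp_const c : fcomp (fconst k c) f = fconst n c.
Proof. by rewrite fconstE fcomp_fpoly mmapC. Qed.

Lemma fcompX i : fcomp (fpsX K i) f = f i.
Proof. by rewrite fpsXE fcomp_fpoly mmapX mmap1U. Qed.

(** For polynomials the chain rule follows from the Leibniz rule; composition
    preserves the order and derivation lowers it by one, whence the general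
    case. *)
Lemma fcomp_chain i h :
  fderiv i (fcomp h f) = \sum_j fcomp (fderiv j h) f * fderiv i (f j).
Proof.
have poly P : fderiv i (mmap (@fconst K n) f P)
    = \sum_j mmap (@fconst K n) f (mderiv j P) * fderiv i (f j).
  have D0 c : fderiv i (mmap (@fconst K n) f c%:MP)
    = \sum_j mmap (@fconst K n) f (mderiv j c%:MP) * fderiv i (f j).
    rewrite mmapC fderiv_const big1 // => j _.
    by rewrite mderivC raddf0 mul0r.
  have DM P1 P2 : fderiv i (mmap (@fconst K n) f P1)
      = \sum_j mmap (@fconst K n) f (mderiv j P1) * fderiv i (f j) ->
    fderiv i (mmap (@fconst K n) f P2)
      = \sum_j mmap (@fconst K n) f (mderiv j P2) * fderiv i (f j) ->
    fderiv i (mmap (@fconst K n) f (P1 * P2))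
      = \sum_j mmap (@fconst K n) f (mderiv j (P1 * P2)) * fderiv i (f j).
    move=> H1 H2; rewrite rmorphM fderivM H1 H2 mulr_suml mulr_sumr -big_split.
    apply: eq_bigr => j _; rewrite mderivM rmorphD !rmorphM /=.
    by rewrite mulrDl mulrAC mulrA.
  rewrite [P]mpolyE; elim/big_ind: _ => [|P1 P2 H1 H2|a _].
  - by have := D0 0; rewrite mpolyC0.
  - rewrite !raddfD /= H1 H2 -big_split; apply: eq_bigr => j _.
    by rewrite !raddfD mulrDl.
  - rewrite -mul_mpolyC; apply: (DM _ _ (D0 _)); rewrite mpolyXE_id.
    elim/big_ind: _ => [||j _]; [by have := D0 1; rewrite mpolyC1|exact: DM|].
    elim: (a j) => [|e IH]; first by rewrite expr0; have := D0 1; rewrite mpolyC1.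
    rewrite exprS; apply: DM IH; rewrite mmapX mmap1U (bigD1 j) //=.
    rewrite mderivX mnm1E eqxx subUU mpolyX0 scale1r rmorph1 mul1r big1 ?addr0 //.
    move=> l lj; rewrite mderivX mnm1E eq_sym (negPf lj) scale0r raddf0.
    by rewrite mul0r.
apply/eqP; rewrite -subr_eq0; apply/eqP/ordge_eq0 => d.
have [P [p -> Hp]] := ordge_fpoly d.+1 h.
rewrite fcompD raddfD /= fcomp_fpoly poly.
rewrite [X in X - _]addrC -addrA; apply: ordgeD.
  by apply/ordge_deriv/ordge_comp.
rewrite -sumrB; apply: ordge_sum => j.
rewrite raddfD /= fderiv_fpoly fcompD fcomp_fpoly mulrDl opprD addrA subrr sub0r.
by apply/ordgeN/ordgeMr/ordge_comp/ordge_deriv.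
Qed.

End Composition.

(** Polynomials are dense for the topology given by the order. *)
Lemma fhom_ext (K : numFieldType) (n k : nat)
    (u w : {rmorphism fps K k -> fps K n}) :
  (forall d h, ordge d h -> ordge d (u h)) ->
  (forall d h, ordge d h -> ordge d (w h)) ->
  (forall c, u (fconst k c) = w (fconst k c)) ->
  (forall i, u (fpsX K i) = w (fpsX K i)) -> u =1 w.
Proof.
move=> ud wd uc uX h; apply/eqP; rewrite -subr_eq0; apply/eqP/ordge_eq0 => d.
have [P [p -> Hp]] := ordge_fpoly d h.
have uP : u (fpoly P) = w (fpoly P).
  rewrite [P]mpolyE !rmorph_sum; apply: eq_bigr => a _.
  rewrite -mul_mpolyC !rmorphM /= -fconstE uc; congr (_ * _).
  rewrite mpolyXE_id !rmorph_prod; apply: eq_bigr => i _.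
  by rewrite !rmorphXn /= -fpsXE uX.
by rewrite !rmorphD /= uP opprD addrACA subrr add0r; apply/ordgeB; auto.
Qed.

(** * The ring of germs *)

Section Germ.

Variables (K : numFieldType) (n : nat).
Local Notation A := (germ K n).
Implicit Types (a b h : A) (c : K).

Lemma gvalD a b : gval (a + b) = gval a + gval b. Proof. by []. Qed.
Lemma gvalM a b : gval (a * b) = gval a * gval b. Proof. by []. Qed.

Lemma germ_domain a b : a * b = 0 -> a = 0 \/ b = 0.
Proof.
by move=> /(congr1 val) /fps_domain[] E; [left | right]; apply: val_inj.
Qed.

(** Invertibility is decided classically: that a germ with nonzero value at 0
    is invertible is a consequence of the division theorem, see germ_unitE. *)
Definition germ_unit : {pred A} := [pred a | `[< exists b, b * a = 1 >]].

Definition germ_inv a : A :=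
  if pselect (exists b, b * a = 1) is left ex then projT1 (cid ex) else a.

Fact germ_mulVr : {in germ_unit, left_inverse 1 germ_inv *%R}.
Proof.
move=> a /asboolP ex; rewrite /germ_inv; case: pselect => // {}ex.
by case: cid.
Qed.

Fact germ_unitP a b : b * a = 1 -> a \in germ_unit.
Proof. by move=> ba; apply/asboolP; exists b. Qed.

Fact germ_invr_out : {in [predC germ_unit], germ_inv =1 id}.
Proof.
move=> a; rewrite inE => /negP nu; rewrite /germ_inv; case: pselect => // ex.
by case: nu; apply/asboolP.
Qed.

HB.instance Definition _ := GRing.ComNzRing_hasMulInverse.Build (germ K n)
  germ_mulVr germ_unitP germ_invr_out.

Fact germ_integral : GRing.integral_domain_axiom A.
Proof. by move=> a b /germ_domain[] ->; rewrite eqxx ?orbT. Qed.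

HB.instance Definition _ :=
  GRing.ComUnitRing_isIntegral.Build (germ K n) germ_integral.

Lemma convergent_const c : fconst n c \in @convergent K n.
Proof.
apply/convergentP; exists 1; first exact: ltr01.
exists `|c| => -[|d]; first by rewrite /psum big1 // => -[].
rewrite /psum (bigD1 bm0) // big1 /= => [|m].
  by rewrite eqxx mdeg0 expr0 !mulr1 addr0.
by rewrite bmeqP /= => /negPf ->; rewrite mulr0 normr0 mul0r.
Qed.

Definition gconst c : A := Germ (convergent_const c).

Lemma gconstB : {morph gconst : c d / c - d}.
Proof. by move=> c d; apply/val_inj/fconstB. Qed.
Lemma gconst1 : gconst 1 = 1.
Proof. exact/val_inj/fconst1. Qed.
Lemma gconstM : {morph gconst : c d / c * d}.
Proof. by move=> c d; apply/val_inj/fconstM. Qed.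

HB.instance Definition _ :=
  GRing.isZmodMorphism.Build K A gconst gconstB.
HB.instance Definition _ :=
  GRing.isMonoidMorphism.Build K A gconst (gconst1, gconstM).

Lemma gcoef_const c a m : (gconst c * a) m = c * a m.
Proof. exact: fconst_mul. Qed.

Lemma gcoefM0 a b : (a * b) 0%MM = a 0%MM * b 0%MM.
Proof. exact: fcoefM0. Qed.

Lemma gcoef_sum m (I : Type) (r : seq I) (Q : pred I) (F : I -> A) :
  (\sum_(i <- r | Q i) F i) m = \sum_(i <- r | Q i) F i m.
Proof. by elim/big_rec2: _ => // i y x _ <-. Qed.

Lemma unit_coef0 a : a \is a GRing.unit -> a 0%MM != 0.
Proof.
move=> /divrr /(congr1 (fun h : A => h 0%MM)); rewrite gcoefM0.
rewrite [X in _ = X]/= eqxx => E; apply/eqP => a0; move/eqP: E.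
by rewrite a0 mul0r eq_sym oner_eq0.
Qed.

Lemma gderivB i : {morph (@gderiv K n i) : a b / a - b}.
Proof. by move=> a b; apply/val_inj/fderivB. Qed.
HB.instance Definition _ i :=
  GRing.isZmodMorphism.Build A A (gderiv i) (gderivB i).

Lemma gderivM i a b : gderiv i (a * b) = gderiv i a * b + a * gderiv i b.
Proof. exact/val_inj/fderivM. Qed.

Lemma gderivX i j : gderiv i (gX K j) = (i == j)%:R :> A.
Proof. by apply/val_inj; rewrite /= fderivX; case: eqP. Qed.

Lemma gderiv_const i c : gderiv i (gconst c) = 0.
Proof. exact/val_inj/fderiv_const. Qed.

End Germ.

Arguments gconst {K} n c.

(** * Vector fields *)

Section VectorFields.

Variables (K : numFieldType) (n : nat).
Local Notation A := (germ K n).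
Implicit Types (a b h : A) (c : K) (xi : 'rV[A]_n).

Lemma vappB xi : {morph (vapp xi) : a b / a - b}.
Proof.
by move=> a b; rewrite /vapp -sumrB; apply: eq_bigr => i _; rewrite raddfB mulrBr.
Qed.

HB.instance Definition _ xi :=
  GRing.isZmodMorphism.Build A A (vapp xi) (vappB xi).

Lemma vappM xi a b : vapp xi (a * b) = vapp xi a * b + a * vapp xi b.
Proof.
rewrite /vapp mulr_suml mulr_sumr -big_split; apply: eq_bigr => i _ /=.
by rewrite gderivM; ring.
Qed.

Lemma vapp1 xi : vapp xi 1 = 0.
Proof.
by rewrite -(gconst1 K n) /vapp big1 // => i _; rewrite gderiv_const mulr0.
Qed.

Lemma vappX xi i : vapp xi (gX K i) = xi 0 i.
Proof.
rewrite /vapp (bigD1 i) //= gderivX eqxx mulr1 big1 ?addr0 // => j ji.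
by rewrite gderivX (negPf ji) mulr0.
Qed.

Lemma vapp_mul m (c : 'rV[A]_m) (S : 'M_(m, n)) h :
  vapp (c *m S) h = \sum_j c 0 j * vapp (row j S) h.
Proof.
rewrite /vapp (eq_bigr (fun i => \sum_j c 0 j * S j i * gderiv i h)).
  rewrite exchange_big; apply: eq_bigr => j _ /=; rewrite mulr_sumr.
  by apply: eq_bigr => i _; rewrite mxE mulrA.
by move=> i _; rewrite mxE mulr_suml.
Qed.

Definition along (v : 'I_n -> K) : 'rV[A]_n := \row_i gconst n (v i).

Lemma along_coef v h m :
  vapp (along v) h m = \sum_i v i * (h (m + U_(i))%MM *+ (m i).+1).
Proof.
by rewrite /vapp gcoef_sum; apply: eq_bigr => i _; rewrite mxE gcoef_const.
Qed.

End VectorFields.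

(** * Pullback of germs *)

Section Pullback.

Variables (K : numFieldType) (n k : nat) (f : mapgerm K n k).
Local Notation A := (germ K n).
Local Notation B := (germ K k).
Implicit Types (g h : B).

(** The map f^*, with its argument last so that it is a ring morphism. *)
Definition pull h : A := gcomp h f.

Lemma pullB : {morph pull : g h / g - h}.
Proof. by move=> g h; apply/val_inj/fcompB. Qed.

Lemma pull1 : pull 1 = 1.
Proof.
by apply/val_inj; have := fcomp_const (mapcomp0 f) 1; rewrite !rmorph1.
Qed.

Lemma pullM : {morph pull : g h / g * h}.
Proof. by move=> g h; apply/val_inj/fcompM; apply: mapcomp0. Qed.

HB.instance Definition _ := GRing.isZmodMorphism.Build B A pull pullB.
HB.instance Definition _ := GRing.isMonoidMorphism.Build B A pull (pull1, pullM).

Lemma pullD : {morph pull : g h / g + h}.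
Proof. exact: rmorphD. Qed.

Lemma pullX i : pull (gX K i) = f i.
Proof. by apply/val_inj/fcompX; apply: mapcomp0. Qed.

Lemma pull_const c : pull (gconst k c) = gconst n c.
Proof. by apply/val_inj/fcomp_const; apply: mapcomp0. Qed.

Lemma pull_coef0 h : (pull h) 0%MM = h 0%MM.
Proof.
have [c [h' E h'0]] : exists c, exists2 h', h = gconst k c + h' & h' 0%MM = 0.
  exists (h 0%MM), (h - gconst k (h 0%MM)); first by rewrite addrC subrK.
  by rewrite fcoefD fcoefN /= eqxx mulr1 subrr.
rewrite E pullD pull_const !fcoefD h'0.
have E0 : pull h' 0%MM = 0 by apply/ordge1P/ordge_comp/ordge1P.
by rewrite E0 !addr0 /= !eqxx.
Qed.

Lemma vapp_pull xi h :
  vapp xi (pull h) = \sum_j pull (gderiv j h) * vapp xi (f j).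
Proof.
rewrite /vapp; under [RHS]eq_bigr do rewrite mulr_sumr.
rewrite exchange_big; apply: eq_bigr => i _ /=.
have -> : gderiv i (pull h) = \sum_j pull (gderiv j h) * gderiv i (f j).
  apply: val_inj; rewrite /= (fcomp_chain (mapcomp0 f)).
  by rewrite -[RHS]/(val _) (raddf_sum val).
by rewrite mulr_sumr; apply: eq_bigr => j _; rewrite mulrCA.
Qed.

End Pullback.

(** * Neumann series *)

Section Neumann.

Variables (K : numFieldType) (n : nat).
Implicit Types (p q : fps K n) (m : 'X_{1..n}).

(** Partial sums of a weighted l^1 norm. For a multiplicative weight it is
    submultiplicative, being the norm of psum for radius 1 after rescaling of
    the coefficients. *)
Definition wsum (w : 'X_{1..n} -> K) d p :=
  \sum_(m : 'X_{1..n < d}) `|p m| * w m.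

Lemma wsumM w d p q : (forall m, 0 <= w m) ->
  (forall a b, w (a + b)%MM = w a * w b) ->
  wsum w d (p * q) <= wsum w d p * wsum w d q.
Proof.
move=> w0 wM; pose sc p : fps K n := FPS (fun m => p m * w m).
have scE r : wsum w d r = psum d 1 (sc r).
  by apply: eq_bigr => m _; rewrite expr1n mulr1 normrM (ger0_norm (w0 m)).
rewrite !scE; have -> : sc (p * q) = sc p * sc q; last first.
  exact: psumM ler01.
apply: fpsP => m; rewrite (fcoefM (sc p) _ (ltnSn (mdeg m))).
rewrite -[LHS]/((p * q) m * w m) (fcoefM p _ (ltnSn (mdeg m))) mulr_suml.
apply: eq_bigr => -[a b] /= /eqP E.
by rewrite [in LHS](congr1 w E) wM mulrACA.
Qed.

Lemma wsum_ge0 w d p : (forall m, 0 <= w m) -> 0 <= wsum w d p.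
Proof. by move=> w0; apply: sumr_ge0 => m _; rewrite mulr_ge0. Qed.

Variables (nu : 'X_{1..n} -> nat) (T : fps K n -> fps K n).
Hypothesis TB : {morph T : p q / p - q}.

(** The analogue of ordge for a weight nu on monomials. *)
Definition wordge d p := forall m, (nu m < d)%N -> p m = 0.

Hypothesis T_raises : forall d p, wordge d p -> wordge d.+1 (T p).

Lemma wordge_fixed q : q = T q -> q = 0.
Proof.
move=> E; apply: fpsP => m.
suff H d : wordge d q by apply: (H (nu m).+1).
by elim: d => [|d IH] //; rewrite E; apply: T_raises.
Qed.

(** The sum of all T^k q0. The operator T raises the weight, so that the
    coefficient of m receives nothing from the terms with k > nu m, and no limit
    is needed. *)
Definition neumann q0 : fps K n :=
  FPS (fun m => \sum_(k < (nu m).+1) iter k T q0 m).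

Lemma iter_wordge q0 k : wordge k (iter k T q0).
Proof. by elim: k => [|k IH] //=; apply: T_raises. Qed.

Lemma neumann_trunc q0 m d : (nu m < d)%N ->
  neumann q0 m = \sum_(k < d) iter k T q0 m.
Proof.
move=> md; rewrite -(big_mkord xpredT (fun k => iter k T q0 m)).
rewrite (@big_cat_nat _ _ _ (nu m).+1) //= big_mkord.
rewrite [X in _ + X]big_nat_cond [X in _ + X]big1 ?addr0 // => k.
by rewrite andbT => /andP[mk _]; apply: (iter_wordge q0).
Qed.

Lemma neumannE q0 : neumann q0 = q0 + T (neumann q0).
Proof.
apply: fpsP => m; pose d := (nu m).+1.
pose s := \sum_(k < d) iter k T q0.
have T0 : T 0 = 0 by rewrite -[0 in LHS](subrr (0 : fps K n)) TB subrr.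
have TN p : T (- p) = - T p by rewrite -sub0r TB T0 sub0r.
have TD p q : T (p + q) = T p + T q by rewrite -{1}[q]opprK TB TN opprK.
have rest : wordge d (neumann q0 - s).
  move=> l ld; rewrite fcoefD fcoefN fcoef_sum (neumann_trunc _ ld).
  by rewrite subrr.
have -> : T (neumann q0) = T (neumann q0 - s) + T s by rewrite -TD subrK.
rewrite !fcoefD (T_raises rest) ?ltnS ?leqnSn // add0r.
rewrite (@neumann_trunc _ _ d.+1) 1?ltnW // big_ord_recl /=.
congr (_ + _).
rewrite /s; have -> : T (\sum_(k < d) iter k T q0) = \sum_(k < d) T (iter k T q0).
  by elim/big_rec2: _ => // i y x _ <-.
by rewrite fcoef_sum.
Qed.

(** An operator of norm at most 1/2: compare with a geometric series. *)
Lemma neumann_bound w q0 C : (forall m, 0 <= w m) ->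
  (forall p D, (forall d, wsum w d p <= D) ->
               forall d, wsum w d (T p) <= D / 2%:R) ->
  (forall d, wsum w d q0 <= C) -> forall d, wsum w d (neumann q0) <= C *+ 2.
Proof.
move=> w0 wT q0C d; pose L := (\max_(m : 'X_{1..n < d}) nu m).+1.
have C0 : 0 <= C by apply: le_trans (q0C 0%N); apply: wsum_ge0.
have iterC k e : wsum w e (iter k T q0) <= C / 2%:R ^+ k.
  elim: k e => [|k IH] e; first by rewrite expr0 divr1.
  by rewrite exprSr invfM mulrA; apply: wT.
apply: (@le_trans _ _ (\sum_(k < L) wsum w d (iter k T q0))).
  rewrite exchange_big; apply: ler_sum => m _.
  have mL : (nu m < L)%N by rewrite ltnS (leq_bigmax m).
  by rewrite (neumann_trunc _ mL) -mulr_suml ler_wpM2r // ler_norm_sum.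
apply: (@le_trans _ _ (\sum_(k < L) C / 2%:R ^+ k)).
  by apply: ler_sum => k _.
have -> : \sum_(k < L) C / 2%:R ^+ k = C *+ 2 - C *+ 2 / 2%:R ^+ L.
  elim: L => [|l IH]; first by rewrite big_ord0 expr0 divr1 subrr.
  rewrite big_ord_recr /= IH exprSr invfM.
  move: (2%:R ^- l) => x; have -> : C * x = C *+ 2 * (x / 2%:R) by field.
  by rewrite [_ / 2%:R in RHS]mulrC; field.
by rewrite lerBlDr lerDl divr_ge0 ?mulrn_wge0 // exprn_ge0 // ler0n.
Qed.

End Neumann.

(** * Weierstrass division along a coordinate *)

Section Shift.

Variables (K : numFieldType) (n : nat).
Implicit Types (p q : fps K n) (m b : 'X_{1..n}).

Definition fshift b p : fps K n := FPS (fun m => p (m + b)%MM).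

Lemma fshiftB b : {morph (fshift b) : p q / p - q}.
Proof. by []. Qed.

Lemma wsum_shift (w : 'X_{1..n} -> K) d b p : (forall m, 0 <= w m) ->
  (forall a c, w (a + c)%MM = w a * w c) ->
  wsum w d (fshift b p) * w b <= wsum w (d + mdeg b) p.
Proof.
move=> w0 wM.
have eP (m : 'X_{1..n < d}) : (mdeg (m + b)%MM < d + mdeg b)%N.
  by rewrite mdegD ltn_add2r bmdeg.
pose e (m : 'X_{1..n < d}) := BMultinom (eP m).
have e_inj : injective e.
  by move=> x y /(congr1 val) /= /addIm xy; apply: val_inj.
apply: le_trans (ler_sum_inj (F := fun m : 'X_{1..n < d + mdeg b} =>
  `|p m| * w m) e_inj _) => [|m]; last by rewrite mulr_ge0.
by rewrite mulr_suml; apply: ler_sum => m _ /=; rewrite wM mulrA.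
Qed.

Lemma convergent_shift b p : p \in @convergent K n -> fshift b p \in @convergent K n.
Proof.
move=> /convergentP[r r0 [C pC]]; apply/convergentP; exists r => //.
exists (C / r ^+ mdeg b) => d; rewrite ler_pdivlMr ?exprn_gt0 //.
apply: le_trans (pC (d + mdeg b)%N).
apply: (wsum_shift (w := fun m => r ^+ mdeg m)) => [m|a c].
  by rewrite exprn_ge0 // ltW.
by rewrite mdegD exprD.
Qed.

Lemma convergent_dom p q : (forall m, `|q m| <= `|p m|) ->
  p \in @convergent K n -> q \in @convergent K n.
Proof.
move=> qp /convergentP[r r0 [C pC]]; apply/convergentP; exists r => //.
exists C => d; apply: le_trans (pC d); apply: ler_sum => m _.
by rewrite ler_wpM2r ?exprn_ge0 // ltW.
Qed.

Lemma fcoefMX p b m :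
  (p * fpoly 'X_[b]) m = if (b <= m)%MM then p (m - b)%MM else 0.
Proof.
case: ifP => [bm|bm].
  have [P [q E Hq]] := ordge_fpoly (mdeg m).+1 p.
  have mb : (mdeg (m - b) < (mdeg m).+1)%N by rewrite ltnS mdegB.
  rewrite E mulrDl !fcoefD (ordgeMr _ Hq) // (Hq _ mb) !addr0 -rmorphM.
  by rewrite -[LHS]/(mcoeff m _) -{1}(submK bm) addmC mcoeffMX.
rewrite (fcoefM _ _ (ltnSn (mdeg m))) big1 // => -[a c] /= /eqP E.
rewrite mcoeffX; case: eqP => [bc|_]; last by rewrite mulr0.
by move: (lem_addl a b); rewrite {2}bc -E bm.
Qed.

End Shift.

Section Weierstrass.

Variables (K : numFieldType) (n : nat) (i0 : 'I_n) (M : nat).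
Implicit Types (p q : fps K n) (m b : 'X_{1..n}).

(* Let x be the distinguished variable, and let h have the term x^M but no lower
   power of x alone. If x has weight 1 and the other variables have weight
   M + 1, then all other monomials of h have weight at least M + 1. *)
Let e j : 'X_{1..n} := (U_(i0) *+ j)%MM.
Let nu m := (m i0 + M.+1 * (mdeg m - m i0))%N.

Let le_i0 m : (m i0 <= mdeg m)%N.
Proof. by rewrite mdegE (bigD1 i0) //= leq_addr. Qed.

Let nuD a b : nu (a + b)%MM = (nu a + nu b)%N.
Proof.
rewrite /nu mnmDE mdegD subnDA -addnBAC // -addnBA // mulnDr.
by rewrite addnACA.
Qed.

Let e_i0 j : e j i0 = j. Proof. by rewrite mulmnE mnm1E eqxx mul1n. Qed.
Let mdeg_e j : mdeg (e j) = j.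
Proof.
by elim: j => [|j IH]; rewrite /e ?mulm0n ?mdeg0 // mulmS mdegD mdeg1 -/(e j) IH.
Qed.
Let nu_e j : nu (e j) = j.
Proof. by rewrite /nu e_i0 mdeg_e subnn muln0 addn0. Qed.

Let nu_le m : (nu m <= M)%N -> m = e (m i0) /\ (m i0 <= M)%N.
Proof.
rewrite /nu => H; have E : mdeg m = m i0.
  apply/eqP; rewrite eqn_leq le_i0 andbT -subn_eq0; move: H.
  case: (_ - _)%N => // d H; move: (leq_trans (leq_addl _ _) H).
  by rewrite mulnS leqNgt ltnS leq_addr.
split; last by rewrite (leq_trans (leq_addr _ _) H).
apply/mnmP => j; rewrite mulmnE mnm1E; case: eqP => [<-|/eqP ij].
  by rewrite mul1n.
rewrite mul0n; move: E; rewrite mdegE (bigD1 i0) //= => /eqP.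
rewrite -[X in _ == X]addn0 eqn_add2l sum_nat_eq0 => /forallP/(_ j).
by rewrite eq_sym ij => /eqP.
Qed.

Variable h : fps K n.
Hypothesis hM : h (e M) != 0.
Hypothesis h_low : forall j, (j < M)%N -> h (e j) = 0.

Let c := (h (e M))^-1.
Let h1 := fpoly 'X_[e M] - fconst n c * h.
(* The germ a - q * h has degree less than M in x if and only if q is a fixed
   point of q |-> q0 + T q, where q0 is the part of c * a divisible by x^M,
   divided by x^M. Multiplication by h1 raises weights by M + 1 and division by
   x^M lowers them by M. *)
Let T q := fshift (e M) (q * h1).

Let h1_nu m : (nu m <= M)%N -> h1 m = 0.
Proof.
move=> /nu_le[E mM]; rewrite fcoefD fcoefN fconst_mul /= mcoeffX E.
move: mM; rewrite leq_eqVlt => /predU1P[->|mM].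
  by rewrite eqxx /c mulVf ?subrr.
rewrite h_low // mulr0 subr0; case: eqP => // /(congr1 mdeg).
by rewrite !mdeg_e => EM; rewrite EM ltnn in mM.
Qed.

Let TB : {morph T : p q / p - q}.
Proof. by move=> p q; rewrite /T mulrBl. Qed.

Let T_raises d p : wordge nu d p -> wordge nu d.+1 (T p).
Proof.
move=> pd m; rewrite ltnS => md.
rewrite -[T p m]/((p * h1) (m + e M)%MM) (fcoefM p h1 (ltnSn _)).
rewrite big1 // => -[a b] /eqP E; rewrite -[LHS]/(p a * h1 b).
have [ad|ad] := ltnP (nu a) d; first by rewrite pd ?mul0r.
rewrite h1_nu ?mulr0 //; move: (congr1 nu E); rewrite !nuD nu_e => {}E.
by rewrite -(leq_add2l (nu a)) -E leq_add // (leq_trans md).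
Qed.

Let shiftX p : fshift (e M) (p * fpoly 'X_[e M]) = p.
Proof.
apply: fpsP => m.
by rewrite -[LHS]/((p * fpoly 'X_[e M]) (m + e M)%MM) fcoefMX lem_addl addmK. Qed.

Let TE q : T q = q - fshift (e M) (fconst n c * (q * h)).
Proof.
by rewrite /T /h1 mulrBr fshiftB shiftX mulrCA.
Qed.

(** The hypothesis makes q a fixed point of T. *)
Lemma division_unique q :
  (forall m, (M <= m i0)%N -> (q * h) m = 0) -> q = 0.
Proof.
move=> qh; apply: (wordge_fixed T_raises); rewrite TE.
have -> : fshift (e M) (fconst n c * (q * h)) = 0; last by rewrite subr0.
apply: fpsP => m.
rewrite -[LHS]/((fconst n c * (q * h)) (m + e M)%MM) fconst_mul qh ?mulr0 //.
by rewrite mnmDE e_i0 leq_addl.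
Qed.

(** For the weight rho^nu the operator T has norm O(rho^(M+1)) / rho^M, which is
    at most 1/2 for small rho, so that the Neumann series converges. *)
Lemma division_exists a : h \in @convergent K n -> a \in @convergent K n ->
  exists2 q, q \in @convergent K n &
    forall m, (M <= m i0)%N -> (a - q * h) m = 0.
Proof.
move=> hc ac; pose q0 := fshift (e M) (fconst n c * a).
exists (neumann nu T q0); last first.
  move=> m mM; have := neumannE TB T_raises q0.
  rewrite TE; set q := neumann nu T q0 => /eqP.
  rewrite addrCA -subr_eq0 opprD addrA subrr sub0r oppr_eq0 -fshiftB -mulrBr.
  move=> /eqP /(congr1 (fun p : fps K n => p (m - e M)%MM)).
  rewrite -[LHS]/((fconst n c * (a - q * h)) (m - e M + e M)%MM) submK; last first.
    apply/mnm_lepP => i; rewrite mulmnE mnm1E; case: eqP => [<-|_].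
      by rewrite mul1n.
    by rewrite mul0n.
  rewrite fconst_mul => /eqP; rewrite mulf_eq0 invr_eq0 (negPf hM) /=.
  by move/eqP.
have h1c : h1 \in @convergent K n.
  rewrite rpredB ?rpredM ?convergent_const // /e.
  elim: M => [|j IH]; first by rewrite mulm0n mpolyX0 rmorph1 rpred1.
  by rewrite mulmS mpolyXD fpolyM rpredM // -fpsXE convergentX.
have q0c : q0 \in @convergent K n.
  by apply/convergent_shift/rpredM/ac/convergent_const.
have [r r0 [C [C0 hqC]]] := convergent2P h1c q0c.
(* A radius below both r and 1; then t is chosen so that T has norm at most 1/2
   for the weight (r1 * t)^nu. *)
pose r1 := r / (1 + r).
have r1_gt0 : 0 < r1 by rewrite divr_gt0 // addr_gt0.
have r1r : r1 <= r.
  by rewrite ler_pdivrMr ?addr_gt0 // mulrDr mulr1 lerDl mulr_ge0 // ltW.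
have r1_le1 : r1 <= 1 by rewrite ler_pdivrMr ?addr_gt0 // mul1r lerDr.
pose B := C / r1 ^+ M.
have B0 : 0 <= B by rewrite divr_ge0 // exprn_ge0 // ltW.
pose t := (1 + B *+ 2)^-1.
have t_gt0 : 0 < t by rewrite invr_gt0 ltr_pwDl // mulrn_wge0.
have t_le1 : t <= 1 by rewrite invf_le1 ?lerDl ?mulrn_wge0 // -invr_gt0.
pose w m := (r1 * t) ^+ nu m.
have rt_gt0 : 0 < r1 * t by apply: mulr_gt0.
have rt0 : 0 <= r1 * t by apply: ltW.
have rt1 : r1 * t <= 1 by rewrite mulr_ile1 // ltW.
have w0 m : 0 <= w m by rewrite exprn_ge0.
have wD x y : w (x + y)%MM = w x * w y by rewrite /w nuD exprD.
have nu_ge m : (mdeg m <= nu m)%N.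
  by rewrite -{1}(subnKC (le_i0 m)) leq_add2l leq_pmull.
have h1w d : wsum w d h1 <= C * t ^+ M.+1.
  apply: (@le_trans _ _ (psum d r1 h1 * t ^+ M.+1)); last first.
    apply: ler_wpM2r; first by rewrite exprn_ge0 // ltW.
    by apply: le_trans (proj1 (hqC d)); apply: psum_le => //; apply: ltW.
  rewrite mulr_suml; apply: ler_sum => m _; have [mM|mM] := leqP (nu m) M.
    by rewrite h1_nu // normr0 !mul0r.
  rewrite -mulrA ler_wpM2l // /w exprMn; apply: ler_pM.
  - by rewrite exprn_ge0 // ltW.
  - by rewrite exprn_ge0 // ltW.
  - by rewrite ler_wiXn2l // ltW.
  - by rewrite ler_wiXn2l // ltW.
have wq p d : wsum w d (fshift (e M) p) <= wsum w (d + M) p / (r1 * t) ^+ M.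
  rewrite ler_pdivlMr ?exprn_gt0 //.
  by have := wsum_shift d (e M) p w0 wD; rewrite mdeg_e {2}/w nu_e.
have TB2 s D : (forall d, wsum w d s <= D) ->
    forall d, wsum w d (T s) <= D / 2%:R.
  move=> sD d; apply: le_trans (wq _ _) _.
  rewrite ler_pdivrMr ?exprn_gt0 //.
  apply: le_trans (wsumM _ _ _ w0 wD) _.
  apply: le_trans (ler_pM _ _ (sD _) (h1w _)) _; try exact: wsum_ge0.
  have D0 : 0 <= D by apply: le_trans (sD 0%N); apply: wsum_ge0.
  rewrite -mulrA ler_wpM2l // exprMn exprSr.
  rewrite mulrA mulrAC mulrA ler_wpM2r ?exprn_ge0 ?(ltW t_gt0) //.
  rewrite -ler_pdivrMr ?exprn_gt0 // mulrAC -/B.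
  rewrite ler_pdivrMr; last by rewrite -invr_gt0.
  rewrite -ler_pdivrMl ?invr_gt0 ?ltr0n // invrK mulr_natl.
  by rewrite lerDr ler01.
have q0w d : wsum w d q0 <= C.
  apply: le_trans (proj2 (hqC d)); apply: le_trans (psum_le _ _ _ r1r); last exact: ltW.
  apply: ler_sum => m _; rewrite ler_wpM2l // /w.
  apply: (@le_trans _ _ (r1 ^+ nu m)).
    by rewrite lerXn2r ?nnegrE // ?(ltW r1_gt0) // ler_piMr // ltW.
  by rewrite ler_wiXn2l // ltW.
apply/convergentP; exists ((r1 * t) ^+ M.+1); first exact: exprn_gt0.
exists (C *+ 2) => d.
apply: le_trans (neumann_bound T_raises w0 TB2 q0w d).
apply: ler_sum => m _; rewrite ler_wpM2l // /w -exprM ler_wiXn2l //.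
rewrite /nu -{2}(subnKC (le_i0 m)) mulnDr leq_add2r.
by rewrite leq_pmull.
Qed.

End Weierstrass.

(** * Regular directions *)

Section Regular.

Variables (K : numFieldType) (n : nat).
Implicit Types (p q : fps K n) (v : 'I_n -> K) (a : 'X_{1..n}).

Definition falong v p : fps K n := \sum_i fconst n (v i) * fderiv i p.

Lemma falongB v : {morph (falong v) : p q / p - q}.
Proof.
move=> p q; rewrite /falong -sumrB; apply: eq_bigr => i _.
by rewrite raddfB mulrBr.
Qed.

HB.instance Definition _ v :=
  GRing.isZmodMorphism.Build (fps K n) (fps K n) (falong v) (falongB v).

Lemma falongM v p q : falong v (p * q) = falong v p * q + p * falong v q.
Proof.
rewrite /falong mulr_suml mulr_sumr -big_split; apply: eq_bigr => i _ /=.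
by rewrite fderivM; ring.
Qed.

Lemma falong_const v c : falong v (fconst n c) = 0.
Proof. by rewrite /falong big1 // => i _; rewrite fderiv_const mulr0. Qed.

Lemma falongZ v c p : falong v (fconst n c * p) = fconst n c * falong v p.
Proof. by rewrite falongM falong_const mul0r add0r. Qed.

Lemma falongX v i : falong v (fpsX K i) = fconst n (v i).
Proof.
rewrite /falong (bigD1 i) //= fderivX eqxx mulr1 big1 ?addr0 // => j ji.
by rewrite fderivX (negPf ji) mulr0.
Qed.

Lemma val_along v (h : germ K n) :
  gval (vapp (along v) h) = falong v (gval h).
Proof.
rewrite -[LHS]/(val _) /vapp (raddf_sum val) /=; apply: eq_bigr => i _.
by rewrite mxE.
Qed.

Lemma val_iter_along v m (h : germ K n) :
  gval (iter m (vapp (along v)) h) = iter m (falong v) (gval h).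
Proof. by elim: m => //= m IH; rewrite val_along IH. Qed.

Lemma ordge_along v d p : ordge d.+1 p -> ordge d (falong v p).
Proof. by move=> pd; apply: ordge_sum => i; apply/ordgeMl/ordge_deriv. Qed.

Lemma ordge_iter_along v d j p : ordge (j + d) p -> ordge d (iter j (falong v) p).
Proof.
by elim: j d => //= j IH d pd; apply/ordge_along/IH; rewrite addnS.
Qed.

Lemma iter_alongD v m p q :
  iter m (falong v) (p + q) = iter m (falong v) p + iter m (falong v) q.
Proof. by elim: m => //= m ->; rewrite raddfD. Qed.

Lemma iter_alongB v m p q :
  iter m (falong v) (p - q) = iter m (falong v) p - iter m (falong v) q.
Proof. by elim: m => //= m ->; rewrite raddfB. Qed.

Lemma iter_alongZ v m c p :
  iter m (falong v) (fconst n c * p) = fconst n c * iter m (falong v) p.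
Proof. by elim: m => //= m ->; rewrite falongZ. Qed.

(** The Leibniz formula, for a factor whose second derivatives vanish. *)
Lemma iter_alongXM v m i p :
  iter m.+1 (falong v) (fpsX K i * p)
    = fpsX K i * iter m.+1 (falong v) p
      + fconst n (v i) * iter m (falong v) p *+ m.+1.
Proof.
elim: m => [|m IH].
  by rewrite /= falongM falongX addrC mulr1n.
rewrite iterS IH raddfD /= raddfMn /= falongZ falongM falongX.
by rewrite [in RHS]mulrS addrA [X in X + _ = _]addrC.
Qed.

Lemma iter_along_monomial v a : iter (mdeg a) (falong v) (fpoly 'X_[a]) 0%MM
  = \prod_i v i ^+ a i *+ (mdeg a)`!.
Proof.
move: {2}(mdeg a) (erefl (mdeg a)) => d; elim: d a => [|d IH] a E.
  move/eqP: E; rewrite mdeg_eq0 => /eqP ->.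
  rewrite mdeg0 mpolyX0 rmorph1 fcoef1 eqxx big1 // => i _.
  by rewrite mnm0E expr0.
have /existsP[i ai] : [exists i, a i != 0%N].
  apply/existsP; apply: contrapT => H; suff a0 : mdeg a = 0%N by rewrite a0 in E.
  rewrite mdegE big1 // => i _; apply/eqP; apply: contrapT => /negP ai.
  by apply: H; exists i.
have aE : a = (U_(i) + (a - U_(i)))%MM by rewrite addmC submK // lep1mP.
set b := (a - U_(i))%MM in aE.
have bd : mdeg b = d by move: E; rewrite aE mdegD mdeg1 add1n => -[].
rewrite E aE mpolyXD fpolyM -fpsXE iter_alongXM fcoefD fcoefM0.
rewrite [fpsX K i _]/= eq_sym mnm1_eq0 mul0r add0r.
have -> : (fconst n (v i) * iter d (falong v) (fpoly 'X_[b]) *+ d.+1) 0%MM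
    = v i * iter d (falong v) (fpoly 'X_[b]) 0%MM *+ d.+1.
  by rewrite -fconst_mul; elim: (d.+1) => // l IHl; rewrite !mulrSr -IHl.
rewrite -bd (IH b bd) bd factS mulrnAr -mulrnA mulnC; congr (_ *+ _).
rewrite (bigD1 i) //= [RHS](bigD1 i) //= mnmDE mnm1E eqxx exprS mulrA.
congr (_ * _); apply: eq_bigr => j ji.
by rewrite mnmDE mnm1E eq_sym (negPf ji).
Qed.

Lemma iter_along_ordge v m p : ordge m p ->
  iter m (falong v) p 0%MM
    = (\sum_(a : 'X_{1..n < m.+1}) p a * \prod_i v i ^+ a i) *+ m`!.
Proof.
move=> pm; rewrite -[in LHS](subrK (fpoly (trunc m.+1 p)) p) iter_alongD fcoefD.
have /ordge1P -> : ordge 1 (iter m (falong v) (p - fpoly (trunc m.+1 p))).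
  by apply: ordge_iter_along; rewrite addn1; apply: ordge_trunc.
rewrite add0r /trunc raddf_sum -sumrMnl.
have -> : iter m (falong v)
      (\sum_(a : 'X_{1..n < m.+1}) fpoly (p a *: 'X_[a]))
    = \sum_(a : 'X_{1..n < m.+1}) fconst n (p a)
         * iter m (falong v) (fpoly 'X_[a]).
  rewrite (big_morph _ (iter_alongD v m) (_ : iter m (falong v) 0 = 0)).
    apply: eq_bigr => a _; rewrite -mul_mpolyC fpolyM -fconstE.
    by rewrite iter_alongZ.
  by have := iter_alongB v m 0 0; rewrite !subrr.
rewrite fcoef_sum; apply: eq_bigr => a _; rewrite fconst_mul.
have [am|am] := ltnP (mdeg a) m; first by rewrite pm // !mul0r mul0rn.
have E : m = mdeg a by apply/eqP; rewrite eqn_leq am -ltnS bmdeg.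
rewrite -mulrnAr; congr (_ * _).
by have := iter_along_monomial v a; rewrite -E.
Qed.

(** By uniqueness of digits, the monomials of degree less than N restrict to
    distinct powers of t on the curve v_i = t^(N^i). *)
Lemma base_inj (N : nat) (k : nat) (x y : 'I_k -> nat) :
  (forall i, x i < N)%N -> (forall i, y i < N)%N ->
  (\sum_(i < k) x i * N ^ i = \sum_(i < k) y i * N ^ i)%N -> x =1 y.
Proof.
elim: k x y => [|k IH] x y xN yN; first by move=> _ [].
rewrite !big_ord_recl !expn0 !muln1 => E.
have N0 : (0 < N)%N by apply: leq_ltn_trans (xN ord0).
have tail (z : 'I_k.+1 -> nat) : (\sum_(i < k) z (lift ord0 i) * N ^ lift ord0 i
    = (\sum_(i < k) z (lift ord0 i) * N ^ i) * N)%N.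
  by rewrite big_distrl /=; apply: eq_bigr => i _; rewrite -mulnA -expnSr.
rewrite !tail in E.
have E0 : x ord0 = y ord0.
  have := congr1 (modn^~ N) E.
  by rewrite !(addnC _ (_ * N))%N !modnMDl !modn_small.
move: E; rewrite E0 => /addnI /eqP; rewrite eqn_pmul2r // => /eqP E i.
have [j ->|->] := unliftP ord0 i; last exact: E0.
by apply: (IH (x \o lift ord0) (y \o lift ord0)) => // l /=.
Qed.

(** Up to the factor m!, the m-th derivative of p at 0 along v is the value at v
    of the lowest homogeneous part of p, a nonzero polynomial. *)
Lemma exists_regular p : p != 0 ->
  exists m, exists2 v, ordge m p & iter m (falong v) p 0%MM != 0.
Proof.
move=> p0; have ex : exists d, `[< exists2 a, mdeg a = d & p a != 0 >].
  apply: contrapT => H; case/eqP: p0; apply: fpsP => a; apply/eqP.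
  apply: contrapT => /negP pa; apply: H; exists (mdeg a); apply/asboolP.
  by exists a.
exists (ex_minn ex); case: ex_minnP => m /asboolP[a am pa] mmin.
have pm : ordge m p.
  move=> b bm; apply/eqP; apply: contrapT => /negP pb.
  suff: (m <= mdeg b)%N by rewrite leqNgt bm.
  by apply: mmin; apply/asboolP; exists b.
pose kap (b : 'X_{1..n}) := (\sum_(i < n) b i * m.+1 ^ i)%N.
have bE (b : 'X_{1..n < m.+1}) i : (b i < m.+1)%N.
  by apply: leq_ltn_trans (bmdeg b); rewrite mdegE (bigD1 i) //= leq_addr.
pose P : {poly K} := \sum_(b : 'X_{1..n < m.+1}) p b *: 'X^(kap b).
have am' : (mdeg a < m.+1)%N by rewrite am.
have P0 : P != 0.
  apply: contra pa => /eqP/(congr1 (fun Q : {poly K} => Q`_(kap a))).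
  rewrite coef0 coef_sum (bigD1 (BMultinom am')) //= coefZ coefXn eqxx mulr1.
  rewrite big1 ?addr0 => [->//|b ba]; rewrite coefZ coefXn.
  case: eqP => [E|]; last by rewrite mulr0.
  case/eqP: ba; apply/val_inj/mnmP => i /=; apply/esym.
  exact: (base_inj (fun i => bE (BMultinom am') i) (bE b) E).
have [t Pt] : exists t : nat, ~~ root P t%:R.
  apply: contrapT => H; pose s := [seq i%:R : K | i <- iota 0 (size P)].
  have := @max_poly_roots _ P s P0; rewrite size_map size_iota ltnn.
  have us : uniq s.
    rewrite map_inj_uniq ?iota_uniq // => x y /eqP.
    by rewrite eqr_nat => /eqP.
  move=> Hs; suff: false by []; apply: Hs us.
  apply/allP => x /mapP[t _ ->]; apply: contrapT => /negP Pt.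
  by apply: H; exists t.
(* The direction is a point of the curve of base_inj. *)
exists (fun i => t%:R ^+ (m.+1 ^ i)) => //; rewrite iter_along_ordge //.
rewrite mulrn_eq0 -leqn0 leqNgt fact_gt0 /=; apply: contra Pt => /eqP E.
rewrite rootE; apply/eqP; rewrite -[RHS]E horner_sum; apply: eq_bigr => b _.
rewrite hornerZ hornerXn; congr (_ * _); rewrite /kap -prodrXr.
by apply: eq_bigr => i _; rewrite -exprM mulnC.
Qed.

End Regular.

(** * Division of germs along a coordinate *)

Section CoordinateDivision.

Variables (K : numFieldType) (n : nat) (i0 : 'I_n).
Local Notation A := (germ K n).
Implicit Types (a h q : A) (m : 'X_{1..n}).

Let e j : 'X_{1..n} := (U_(i0) *+ j)%MM.

Lemma gX_expE j : gval (gX K i0 ^+ j) = fpoly 'X_[e j].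
Proof.
elim: j => [|j IH]; first by rewrite expr0 /e mulm0n mpolyX0 rmorph1.
by rewrite exprS gvalM IH /e mulmS mpolyXD fpolyM -fpsXE.
Qed.

Lemma iter_deriv_coef j a : iter j (gderiv i0) a 0%MM = a (e j) *+ j`!.
Proof.
suff H m : iter j (gderiv i0) a m = a (m + e j)%MM *+ (\prod_(l < j) (m i0 + l.+1)).
  rewrite H add0m; congr (_ *+ _); rewrite mnm0E.
  elim: j {H} => [|j IH]; first by rewrite big_ord0.
  by rewrite big_ord_recr /= IH factS mulnC.
elim: j m => [|j IH] m; first by rewrite big_ord0 mulr1n /e mulm0n addm0.
rewrite iterS -[LHS]/(iter j (gderiv i0) a (m + U_(i0))%MM *+ (m i0).+1) IH.
rewrite -mulrnA /e mulmS addmA big_ord_recl addn1 mulnC; congr (_ *+ (_ * _)).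
by apply: eq_bigr => l _; rewrite mnmDE mnm1E eqxx addn1 addSnnS.
Qed.

Lemma gderiv0_coef a m : gderiv i0 a = 0 -> m i0 != 0%N -> a m = 0.
Proof.
move=> /(congr1 (fun b : A => b (m - U_(i0))%MM)) /= + mi.
rewrite submK ?lep1mP // => /eqP; rewrite mulrn_eq0 /= => /eqP; exact.
Qed.

Lemma sum_gX_coef M (r : 'I_M -> A) m :
  (\sum_j r j * gX K i0 ^+ j) m
    = \sum_(j < M) if (e j <= m)%MM then r j (m - e j)%MM else 0.
Proof.
rewrite gcoef_sum; apply: eq_bigr => j _.
by rewrite -[LHS]/((gval (r j) * gval (gX K i0 ^+ j)) m) gX_expE fcoefMX.
Qed.

Let le_e j m : (e j <= m)%MM = (j <= m i0)%N.
Proof.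
apply/mnm_lepP/idP => [/(_ i0)|jm i]; rewrite mulmnE mnm1E.
  by rewrite eqxx mul1n.
by case: eqP => [<-|_]; rewrite ?mul1n ?mul0n.
Qed.

(** The remainder is regrouped according to the powers of the distinguished
    variable. *)
Lemma coord_division M h :
  h (e M) != 0 -> (forall j, (j < M)%N -> h (e j) = 0) -> forall a,
  exists q (r : 'I_M -> A),
    (forall j, gderiv i0 (r j) = 0) /\ a = q * h + \sum_j r j * gX K i0 ^+ j.
Proof.
move=> hM hl a; have [q qc qP] := division_exists hM hl (valP h) (valP a).
pose R := a - Germ qc * h.
pose s j : fps K n := FPS (fun m => if m i0 == 0%N then R (m + e j)%MM else 0).
have sc j : s j \in @convergent K n.
  apply: (convergent_dom (p := fshift (e j) (gval R))) => [m /=|].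
    by case: ifP => //; rewrite normr0.
  exact/convergent_shift/valP.
exists (Germ qc), (fun j => Germ (sc j)); split=> [j|].
  apply/val_inj/fpsP => m /=; rewrite mnmDE mnm1E eqxx addn1 /=.
  by rewrite mul0rn.
apply/eqP; rewrite addrC -subr_eq -/R eq_sym; apply/eqP/val_inj/fpsP => m.
transitivity ((\sum_(j < M) Germ (sc j) * gX K i0 ^+ j) m); first by [].
have sE j l : Germ (sc j) l = if l i0 == 0%N then R (l + e j)%MM else 0 by [].
have eE j : (m - e j)%MM i0 = (m i0 - j)%N.
  by rewrite mnmBE mulmnE mnm1E eqxx mul1n.
rewrite sum_gX_coef -[RHS]/(R m); have [mM|mM] := ltnP (m i0) M; last first.
  have -> : R m = 0 by apply: qP.
  rewrite big1 // => j _; case: ifP => // jm; rewrite sE eE.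
  by rewrite subn_eq0 leqNgt (leq_trans (ltn_ord j) mM).
rewrite (bigD1 (Ordinal mM)) // le_e leqnn sE eE subnn eqxx.
rewrite submK ?le_e // big1 => [|j jm]; first exact: addr0.
rewrite le_e.
case: ifP => // ji; rewrite sE eE subn_eq0.
move: jm; rewrite -val_eqE /= => /negPf jm.
by rewrite leq_eqVlt ltnNge ji orbF eq_sym jm.
Qed.

Lemma coord_division_unique M h q (r : 'I_M -> A) :
  h (e M) != 0 -> (forall j, (j < M)%N -> h (e j) = 0) ->
  (forall j, gderiv i0 (r j) = 0) ->
  q * h = \sum_j r j * gX K i0 ^+ j -> q = 0.
Proof.
move=> hM hl r0 E; apply/val_inj/(division_unique hM hl) => m Mm.
rewrite -[LHS]/((q * h) m) E sum_gX_coef big1 // => j _; case: ifP => // jm.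
apply: gderiv0_coef => //; rewrite mnmBE mulmnE mnm1E eqxx mul1n.
by rewrite subn_eq0 -ltnNge (leq_trans (ltn_ord j)).
Qed.

End CoordinateDivision.

(** Division by a germ of order 0 leaves no remainder. *)
Lemma germ_unitE (K : numFieldType) (n : nat) (a : germ K n) :
  (a \is a GRing.unit) = (a 0%MM != 0).
Proof.
apply/idP/idP => [/unit_coef0 //|a0].
suff [b ba] : exists b, b * a = 1.
  by apply/unitrP; exists b; rewrite [a * b]mulrC.
case: n a a0 => [|n] a a0.
  exists (gconst 0 (a 0%MM)^-1); apply/val_inj/fpsP => m.
  have -> : m = 0%MM by apply/mnmP => -[].
  rewrite -[LHS]/((gconst 0 (a 0%MM)^-1 * a) 0%MM) gcoef_const mulVf //.
  by rewrite /= eqxx.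
have [||q [r [_ E]]] := @coord_division K n.+1 ord0 0 a _ _ 1 => //.
by exists q; rewrite E big_ord0 addr0.
Qed.

(** * Linear changes of coordinates *)

Section FormalPullback.

Variables (K : numFieldType) (n k : nat) (f : mapgerm K n k).

Definition fpullm (h : fps K k) : fps K n := fcomp h (fun i => f i).

Lemma fpullmB : {morph fpullm : g h / g - h}.
Proof. exact: fcompB. Qed.

Lemma fpullmM : {morph fpullm : g h / g * h}.
Proof. by move=> g h; apply/fcompM/mapcomp0. Qed.

Lemma fpullm1 : fpullm 1 = 1.
Proof. by have := fcomp_const (mapcomp0 f) 1; rewrite !rmorph1. Qed.

HB.instance Definition _ :=
  GRing.isZmodMorphism.Build (fps K k) (fps K n) fpullm fpullmB.
HB.instance Definition _ :=
  GRing.isMonoidMorphism.Build (fps K k) (fps K n) fpullm (fpullm1, fpullmM).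

End FormalPullback.

Lemma pull_cancel (K : numFieldType) (n : nat) (S T : mapgerm K n n) :
  (forall i, pull S (T i) = gX K i) -> cancel (pull T) (pull S).
Proof.
move=> ST a; apply: val_inj.
apply: (@fhom_ext K n n (fpullm S \o fpullm T) idfun) => //= [d h hd|c|i].
- by do 2!apply: ordge_comp.
- by rewrite /fpullm !fcomp_const //; apply: mapcomp0.
- rewrite /fpullm fcompX; last exact: mapcomp0.
  by rewrite -[LHS]/(gval (pull S (T i))) ST.
Qed.

Section Direction.

Variables (K : numFieldType) (n : nat) (v : 'I_n -> K) (i0 : 'I_n).
Local Notation A := (germ K n).
Local Notation D := (vapp (along v)).
Implicit Types (a h q : A).

(** The linear automorphisms straighten and unstraighten exchange the derivative
    along v with the partial derivative in direction i0. *)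
Fact straighten_subproof i :
  (gconst n (v i) * gX K i0 + (if i == i0 then 0 else gX K i) : A) 0%MM = 0.
Proof.
have X0 j : gX K j 0%MM = 0 by rewrite /= eq_sym mnm1_eq0.
by rewrite fcoefD gcoef_const X0 mulr0; case: eqP; rewrite ?X0 addr0.
Qed.
Definition straighten : mapgerm K n n := MapGerm straighten_subproof.

Fact unstraighten_subproof i : ((if i == i0 then gconst n (v i0)^-1 * gX K i0
    else gX K i - gconst n (v i / v i0) * gX K i0) : A) 0%MM = 0.
Proof.
have X0 j : gX K j 0%MM = 0 by rewrite /= eq_sym mnm1_eq0.
case: eqP => _; first by rewrite gcoef_const X0 mulr0.
by rewrite fcoefD fcoefN gcoef_const !X0 mulr0 subr0.
Qed.
Definition unstraighten : mapgerm K n n := MapGerm unstraighten_subproof.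

Hypothesis vi0 : v i0 != 0.

Let cV : gconst n (v i0) * gconst n (v i0)^-1 = 1.
Proof. by rewrite -rmorphM /= mulfV // rmorph1. Qed.

Lemma straightenK : cancel (pull straighten) (pull unstraighten).
Proof.
apply: pull_cancel => i /=; rewrite pullD pullM pull_const pullX /= eqxx.
case: eqP => [->|ii]; first by rewrite rmorph0 addr0 mulrA cV mul1r.
by rewrite pullX /= (introF eqP ii) rmorphM /= mulrA addrC subrK.
Qed.

Lemma unstraightenK : cancel (pull unstraighten) (pull straighten).
Proof.
apply: pull_cancel => i /=; case: eqP => [->|ii].
  by rewrite pullM pull_const pullX /= eqxx addr0 mulrA [_ * gconst n (v i0)]mulrC cV mul1r.
rewrite pullB pullM pull_const !pullX /= eqxx (introF eqP ii) addr0.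
by rewrite rmorphM /= -mulrA (mulrA (gconst n (v i0)^-1)) [gconst n (v i0)^-1 * _]mulrC
  cV mul1r addrAC subrr add0r.
Qed.

Lemma deriv_straighten a : gderiv i0 (pull straighten a) = pull straighten (D a).
Proof.
pose e : 'rV[A]_n := \row_i (i == i0)%:R.
have eE b : vapp e b = gderiv i0 b.
  rewrite /vapp (bigD1 i0) //= mxE eqxx mul1r big1 ?addr0 // => i ii.
  by rewrite mxE (negPf ii) mul0r.
rewrite -eE vapp_pull /vapp rmorph_sum; apply: eq_bigr => j _ /=.
rewrite pullM mxE pull_const mulrC; congr (_ * _).
rewrite -/(vapp e _) eE raddfD /= gderivM gderiv_const mul0r add0r gderivX eqxx.
by rewrite mulr1; case: eqP => [_|jj]; rewrite ?raddf0 ?addr0 // gderivX eq_sym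
  (introF eqP jj) addr0.
Qed.

Lemma iter_deriv_straighten j a :
  iter j (gderiv i0) (pull straighten a) = pull straighten (iter j D a).
Proof. by elim: j => //= j ->; rewrite deriv_straighten. Qed.

Definition lcoord : A := gconst n (v i0)^-1 * gX K i0.

Lemma D_lcoord : D lcoord = 1.
Proof.
rewrite vappM vappX mxE [D (gconst n _)]/vapp big1 => [|i _].
  by rewrite mul0r add0r mulrC cV.
by rewrite gderiv_const mulr0.
Qed.

Lemma pull_lcoord : pull straighten lcoord = gX K i0.
Proof.
by have := unstraightenK (gX K i0); rewrite pullX /= eqxx.
Qed.

Variables (M : nat) (h : A).
Hypothesis hM : iter M D h 0%MM != 0.
Hypothesis hlow : forall j, (j < M)%N -> iter j D h 0%MM = 0.

Let hM' : pull straighten h (U_(i0) *+ M)%MM != 0.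
Proof.
have := iter_deriv_coef i0 M (pull straighten h).
rewrite iter_deriv_straighten pull_coef0 => E.
by move: hM; rewrite E mulrn_eq0 negb_or => /andP[].
Qed.

Let hlow' j : (j < M)%N -> pull straighten h (U_(i0) *+ j)%MM = 0.
Proof.
move=> jM; have := iter_deriv_coef i0 j (pull straighten h).
rewrite iter_deriv_straighten pull_coef0 hlow // => /esym/eqP.
by rewrite mulrn_eq0 -leqn0 leqNgt fact_gt0 => /eqP.
Qed.

Lemma direction_division a : exists q (r : 'I_M -> A),
  (forall j, D (r j) = 0) /\ a = q * h + \sum_j r j * lcoord ^+ j.
Proof.
have [q [r [r0 E]]] := coord_division hM' hlow' (pull straighten a).
exists (pull unstraighten q), (fun j => pull unstraighten (r j)); split=> [j|].
  apply: (can_inj straightenK); rewrite rmorph0 -deriv_straighten.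
  by rewrite unstraightenK.
apply: (can_inj straightenK); rewrite E pullD pullM unstraightenK.
rewrite rmorph_sum; congr (_ + _); apply: eq_bigr => j _ /=.
by rewrite pullM unstraightenK rmorphXn /= pull_lcoord.
Qed.

Lemma direction_division_unique q (r : 'I_M -> A) :
  (forall j, D (r j) = 0) -> q * h = \sum_j r j * lcoord ^+ j -> q = 0.
Proof.
move=> r0 E; apply: (can_inj straightenK); rewrite rmorph0.
apply: (coord_division_unique (r := fun j => pull straighten (r j)) hM' hlow').
  by move=> j; rewrite deriv_straighten r0 rmorph0.
rewrite -pullM E rmorph_sum; apply: eq_bigr => j _ /=.
by rewrite pullM rmorphXn /= pull_lcoord.
Qed.

End Direction.

(** * Germs constant along a direction *)

Section Constants.

Variables (K : numFieldType) (n : nat) (v : 'I_n -> K).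
Local Notation A := (germ K n).
Local Notation D := (vapp (along v)).

(** The germs constant along v are the germs in n - 1 variables. Keeping them
    inside the germs in n variables avoids choosing these variables. *)
Definition along_const : {pred A} := [pred a | D a == 0].

Fact along_const_divring : divring_closed along_const.
Proof.
split=> [|a b|a b]; rewrite !inE; first by rewrite vapp1.
  by move=> /eqP a0 /eqP b0; rewrite raddfB /= a0 b0 subrr.
move=> /eqP a0 /eqP b0; rewrite vappM a0 mul0r add0r.
have [bu|bu] := boolP (b \is a GRing.unit); last first.
  by rewrite invr_out // b0 mulr0.
have : D (b * b^-1) = 0 by rewrite divrr // vapp1.
rewrite vappM b0 mul0r add0r => /eqP E.
by rewrite -[D _](mulKr bu) (eqP E) !mulr0.
Qed.

HB.instance Definition _ :=
  GRing.isDivringClosed.Build A along_const along_const_divring.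

Record dconst := DConst { dval :> A; _ : dval \in along_const }.

HB.instance Definition _ := [isSub for dval].
HB.instance Definition _ := [Choice of dconst by <:].
HB.instance Definition _ := [SubChoice_isSubComUnitRing of dconst by <:].
HB.instance Definition _ := [SubComUnitRing_isSubIntegralDomain of dconst by <:].

Lemma D_dconst (c : dconst) : D (dval c) = 0.
Proof. by have := valP c; rewrite inE => /eqP. Qed.

End Constants.

Section Evaluation.

Variables (K : numFieldType) (n : nat) (v : 'I_n -> K) (i0 : 'I_n).
Hypothesis vi0 : v i0 != 0.
Local Notation A := (germ K n).
Local Notation D := (vapp (along v)).
Local Notation O := (dconst v).
Implicit Types (p q : {poly O}) (a : A) (c : O).

(** Remainders of Weierstrass division are polynomials in lcoord over the germs
    constant along v. *)
Definition ev p : A := (map_poly (val : O -> A) p).[lcoord v i0].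

Lemma evB : {morph ev : p q / p - q}.
Proof. by move=> p q; rewrite /ev rmorphB hornerD hornerN. Qed.
Lemma evM : {morph ev : p q / p * q}.
Proof. by move=> p q; rewrite /ev rmorphM hornerM. Qed.
Lemma ev1 : ev 1 = 1.
Proof. by rewrite /ev rmorph1 hornerC. Qed.

HB.instance Definition _ := GRing.isZmodMorphism.Build {poly O} A ev evB.
HB.instance Definition _ := GRing.isMonoidMorphism.Build {poly O} A ev (ev1, evM).

Lemma evD : {morph ev : p q / p + q}.
Proof. exact: rmorphD. Qed.

Lemma evC c : ev c%:P = dval c.
Proof. by rewrite /ev map_polyC hornerC. Qed.

Lemma evX : ev 'X = lcoord v i0.
Proof. by rewrite /ev map_polyX hornerX. Qed.

Lemma evZ c p : ev (c *: p) = dval c * ev p.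
Proof. by rewrite -mul_polyC evM evC. Qed.

Lemma D_ev p : D (ev p) = ev p^`().
Proof.
elim/poly_ind: p => [|p c IH]; first by rewrite deriv0 !rmorph0 raddf0.
rewrite !evD !evM evC evX !raddfD /= D_dconst addr0 vappM IH D_lcoord //.
by rewrite derivM derivX derivC ?rmorph0 ?addr0 evD !evM ev1 evX.
Qed.

Lemma iter_D_ev j p : iter j D (ev p) = ev p^`(j).
Proof. by elim: j => //= j ->; rewrite D_ev. Qed.

(** The highest derivative of a polynomial is a nonzero multiple of its leading
    coefficient. *)
Lemma ev_inj : injective ev.
Proof.
apply: raddf_inj => p p0; apply/eqP; apply: contrapT => /negP pn0.
have : iter (size p).-1 D (ev p) = 0.
  by rewrite p0; elim: (_.-1) => //= l ->; rewrite raddf0.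
rewrite iter_D_ev.
have -> : p^`((size p).-1) = (lead_coef p *+ (size p).-1`!)%:P.
  apply/polyP => j; rewrite coef_derivn coefC; case: j => [|j] /=.
    by rewrite addn0 ffactnn.
  rewrite nth_default ?mul0rn // addnS.
  by case: (size p) => //= l; rewrite ltnS leq_addr.
rewrite evC -[dval _]/(val _) (raddfMn val) /= => /eqP.
rewrite -mulr_natr mulf_eq0 => /orP[/eqP E|].
  have : lead_coef p = 0 by apply: val_inj.
  by move/eqP; rewrite lead_coef_eq0 (negPf pn0).
move/eqP/(congr1 (fun a : A => a 0%MM)).
rewrite -(rmorph_nat (gconst n)) /= eqxx mulr1 => /eqP.
by rewrite pnatr_eq0 -leqn0 leqNgt fact_gt0.
Qed.

Variables (M : nat) (h : A).
Hypothesis hM : iter M D h 0%MM != 0.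
Hypothesis hlow : forall j, (j < M)%N -> iter j D h 0%MM = 0.

Lemma weierstrass_division (a : A) :
  exists q : A, exists2 p : {poly O}, (size p <= M)%N & a = q * h + ev p.
Proof.
have [q [r [r0 E]]] := direction_division vi0 hM hlow a.
have rc j : r j \in along_const v by rewrite inE r0.
exists q, (\sum_(j < M) DConst (rc j) *: 'X^j).
  apply: (leq_trans (size_sum _ _ _)); apply/bigmax_leqP => j _.
  by rewrite (leq_trans (size_scale_leq _ _)) // size_polyXn.
rewrite E rmorph_sum; congr (_ + _); apply: eq_bigr => j _ /=.
by rewrite evZ rmorphXn /= evX.
Qed.

Lemma weierstrass_unique (q : A) p : (size p <= M)%N -> q * h = ev p -> p = 0.
Proof.
move=> pM E; suff q0 : q = 0 by apply: ev_inj; rewrite -E q0 mul0r rmorph0.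
apply: (direction_division_unique vi0 hM hlow
          (r := fun j : 'I_M => dval p`_j)) => [j|]; first exact: D_dconst.
rewrite E /ev (horner_coef_wide _ (n := M)).
  by apply: eq_bigr => j _; rewrite coef_map.
by rewrite (leq_trans (size_poly _ _)).
Qed.

End Evaluation.

(** * Irreducible factors of polynomials *)

(** Divisibility of polynomials over a domain is understood up to nonzero scalar
    factors, that is, over the field of fractions. *)
Section IrreducibleFactors.

Variable R : idomainType.
Implicit Types (p q w : {poly R}).

Lemma exists_irreducible_factor w : (1 < size w)%N ->
  exists2 p, irreducible_poly p & p %| w.
Proof.
move=> w1; have w0 : w != 0 by rewrite -size_poly_gt0 ltnW.
have ex : exists d, `[< exists2 p, p %| w & (1 < size p)%N && (size p == d) >].
  by exists (size w); apply/asboolP; exists w; rewrite ?w1 /=.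
case: (ex_minnP ex) => d /asboolP[p pw /andP[p1 /eqP pd]] dmin.
exists p => //; split=> // q q1 qp; rewrite -dvdp_size_eqp //.
have p0 := dvdpN0 pw w0; have q0 := dvdpN0 qp p0.
rewrite eqn_leq dvdp_leq //= pd; apply: dmin; apply/asboolP.
exists q; first exact: dvdp_trans pw.
by rewrite eqxx andbT ltn_neqAle eq_sym q1 size_poly_gt0.
Qed.

Lemma irreducible_prime p q1 q2 : irreducible_poly p ->
  p %| q1 * q2 -> (p %| q1) || (p %| q2).
Proof.
move=> [p1 pirr]; have [//|npq] := boolP (p %| q1).
rewrite Gauss_dvdpr //; apply/coprimepP => d dp dq.
rewrite -size_poly_eq1; apply: contraNT npq => d1.
by rewrite -(eqp_dvdl _ (pirr d d1 dp)).
Qed.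

End IrreducibleFactors.

(** * Prime ideals *)

Section PrimeIdeals.

Variables (K : numFieldType) (n : nat).
Local Notation A := (germ K n).
Implicit Types (P Q : {pred A}) (a b c g h : A).

Lemma zerosP h a : reflect (exists c, a = c * h) (a \in zeros h).
Proof. by rewrite inE; apply: asboolP. Qed.

Section OnePrime.

Variable P : {pred A}.
Hypothesis Pprime : prime_ideal P.

Lemma prime0 : 0 \in P. Proof. by case: Pprime => -[]. Qed.
Lemma prime1 : 1 \notin P. Proof. by case: Pprime => -[]. Qed.
Lemma primeD a b : a \in P -> b \in P -> a + b \in P.
Proof.
by case: Pprime => -[_ _ PM] _ aP bP; rewrite -[a]mul1r; apply: PM.
Qed.
Lemma primeMl a b : b \in P -> a * b \in P.
Proof.
case: (Pprime) => -[P0 _ PM] _ bP; rewrite -[_ * _]addr0; exact: PM.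
Qed.
Lemma primeMr a b : a \in P -> a * b \in P.
Proof. by rewrite mulrC; apply: primeMl. Qed.
Lemma primeN a : a \in P -> - a \in P.
Proof. by rewrite -mulN1r; apply: primeMl. Qed.
Lemma primeB a b : a \in P -> b \in P -> a - b \in P.
Proof. by move=> aP bP; apply/primeD/primeN. Qed.
Lemma prime_sum (I : finType) (F : I -> A) :
  (forall i, F i \in P) -> \sum_i F i \in P.
Proof. by move=> FP; elim/big_ind: _ => //; [apply: prime0|apply: primeD]. Qed.
Lemma primeMP a b : a * b \in P -> a \notin P -> b \in P.
Proof. by case: Pprime => _ PP /PP /orP[->|]. Qed.
Lemma primeMn a b : a \notin P -> b \notin P -> a * b \notin P.
Proof. by move=> aP bP; apply: contra bP => /primeMP ->. Qed.
Lemma primeX e a : a ^+ e \in P -> a \in P.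
Proof.
elim: e => [|e IH]; first by rewrite expr0 (negPf prime1).
by rewrite exprS => H; apply: contraT => aP; rewrite -(negPf aP) (IH (primeMP H aP)).
Qed.
Lemma unit_notin a : a \is a GRing.unit -> a \notin P.
Proof.
by move=> au; apply: contra prime1 => aP; rewrite -(mulVr au) primeMl.
Qed.

End OnePrime.

(** A nonzero series has a partial derivative, of some order, which is a
    unit. *)
Lemma deriv_stable_unit (S : A -> Prop) a : a != 0 -> S a ->
  (forall b i, S b -> S (gderiv i b)) -> exists2 b, S b & b \is a GRing.unit.
Proof.
move=> a0 Sa SD; have [m am] : exists m, a m != 0.
  apply: contrapT => H; case/eqP: a0; apply/val_inj/fpsP => m; apply/eqP.
  by apply: contrapT => /negP am; apply: H; exists m.
move: {2}(mdeg m) (erefl (mdeg m)) => d; elim: d => [|d IH] in a a0 Sa m am *.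
  move=> /eqP; rewrite mdeg_eq0 => /eqP m0.
  by exists a => //; rewrite germ_unitE; rewrite m0 in am.
move=> E; have /existsP[i mi] : [exists i, m i != 0%N].
  apply/existsP; apply: contrapT => H; suff m0 : mdeg m = 0%N by rewrite m0 in E.
  rewrite mdegE big1 // => i _; apply/eqP; apply: contrapT => /negP mi.
  by apply: H; exists i.
have mE : m = (U_(i) + (m - U_(i)))%MM by rewrite addmC submK // lep1mP.
have am' : gderiv i a (m - U_(i))%MM != 0.
  by rewrite /= submK ?lep1mP // mulrn_eq0 negb_or am.
apply: (IH (gderiv i a) _ (SD _ i Sa) _ am').
  by apply: contra am' => /eqP ->.
by move: E; rewrite {1}mE mdegD mdeg1 add1n => -[].
Qed.

Lemma gderivC i j a : gderiv i (gderiv j a) = gderiv j (gderiv i a).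
Proof.
have [->//|ij] := eqVneq i j; apply/val_inj/fpsP => m /=.
rewrite !mnmDE !mnm1E [j == i]eq_sym (negPf ij) !addn0 -!mulrnA mulnC.
by rewrite -!addmA [(U_(i) + _)%MM]addmC.
Qed.

Lemma D_gderiv (v : 'I_n -> K) i a :
  vapp (along v) (gderiv i a) = gderiv i (vapp (along v) a).
Proof.
rewrite /vapp raddf_sum; apply: eq_bigr => j _ /=.
by rewrite mxE gderivM gderiv_const mul0r add0r gderivC.
Qed.

(** The localization of the ring at P has principal maximal ideal: for P
    nonzero, P is the ideal of an irreducible hypersurface. *)
Definition principal_at P : Prop :=
  exists2 pi, pi \in P &
    forall a, a \in P -> exists2 c, c \notin P & exists u, c * a = pi * u.

Lemma exists_coordinate m (v : 'I_n -> K) a :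
  (0 < m)%N -> iter m (vapp (along v)) a 0%MM != 0 -> exists i, v i != 0.
Proof.
case: m => // m _ am; apply: contrapT => H; case/negP: am.
rewrite iterS along_coef big1 // => i _.
have -> : v i = 0 by apply/eqP; apply: contrapT => /negP vi; apply: H; exists i.
by rewrite mul0r.
Qed.

End PrimeIdeals.

(** * Weierstrass polynomials *)

Section WeierstrassPolynomial.

Variables (K : numFieldType) (n : nat) (v : 'I_n -> K) (i0 : 'I_n).
Hypothesis vi0 : v i0 != 0.
Local Notation A := (germ K n).
Local Notation D := (vapp (along v)).
Local Notation O := (dconst v).
Local Notation ev := (@ev K n v i0).
Implicit Types (p q : {poly O}) (a : A) (c : O).

Variables (M : nat) (h : A).
Hypothesis hM : iter M D h 0%MM != 0.
Hypothesis hlow : forall j, (j < M)%N -> iter j D h 0%MM = 0.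

(** With x = lcoord, take x^M minus its remainder on division by h. By
    uniqueness of remainders, a polynomial in the ideal of h is a multiple of
    it. *)
Lemma weierstrass_polynomial : exists W : {poly O},
  [/\ size W = M.+1, exists q : A, ev W = q * h, iter M D (ev W) 0%MM != 0 &
      forall p (b : A), ev p = b * h -> W %| p].
Proof.
have [q0 [p0 p0M E]] := weierstrass_division vi0 hM hlow (ev 'X^M).
pose W := 'X^M - p0; have sW : size W = M.+1.
  by rewrite size_polyDl ?size_polyXn // size_polyN ltnS.
have Wm : W \is monic.
  rewrite monicE lead_coefE sW coefB coefXn eqxx /= nth_default ?subr0 //.
have evW : ev W = q0 * h by rewrite evB E addrK.
exists W; split=> //; first by exists q0.
  rewrite (iter_D_ev vi0) /W derivnB derivnXn subnn expr0.
  rewrite derivn_poly0 // subr0 ffactnn rmorphMn rmorph1.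
  rewrite -(rmorph_nat (gconst n)) /= eqxx mulr1 pnatr_eq0 -leqn0 leqNgt.
  by rewrite fact_gt0.
move=> p b pE; rewrite /dvdp; apply/eqP.
apply: (weierstrass_unique vi0 hM hlow (q := b - ev (p %/ W) * q0)).
  by rewrite -ltnS -sW ltn_modpN0 // monic_neq0.
have pW := Pdiv.IdomainMonic.divp_eq Wm p.
have -> : ev (p %% W) = ev p - ev (p %/ W) * ev W.
  by rewrite -evM -evB {2}pW addrC addKr.
by rewrite pE evW mulrBl mulrA.
Qed.

End WeierstrassPolynomial.

Section AssociatedPrimes.

Variables (K : numFieldType) (n : nat).
Local Notation A := (germ K n).
Implicit Types (a b d h : A) (P Q : {pred A}).

Lemma regular_direction h : h != 0 -> h \isn't a GRing.unit ->
  exists m v i0, [/\ (0 < m)%N, v i0 != 0, ordge m h &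
    iter m (vapp (@along K n v)) h 0%MM != 0].
Proof.
move=> h0 hu; have : gval h != 0 by [].
move=> /exists_regular[m [v hm]]; rewrite -val_iter_along => hv.
case: m => [|m] in hm hv *; first by rewrite germ_unitE in hu; case/negP: hu.
have [i0 vi0] := exists_coordinate (ltn0Sn m) hv.
by exists m.+1, v, i0.
Qed.

Lemma ordge_iter_low m v h j : ordge m h -> (j < m)%N ->
  iter j (vapp (@along K n v)) h 0%MM = 0.
Proof.
move=> hm jm; apply/ordge1P; rewrite val_iter_along; apply: ordge_iter_along.
by apply: ordgeW hm; rewrite addn1.
Qed.

Lemma iter_along_unit m v h q : ordge m h ->
  iter m (vapp (@along K n v)) (q * h) 0%MM
    = q 0%MM * iter m (vapp (@along K n v)) h 0%MM.
Proof.
move=> hm; pose q' : A := q - gconst n (q 0%MM).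
have q'0 : ordge 1 q'.
  by apply/ordge1P; rewrite /q' fcoefD fcoefN /= eqxx mulr1 subrr.
rewrite !val_iter_along -[q in LHS](subrK (gconst n (q 0%MM))) -/q' mulrDl.
rewrite gvalD iter_alongD fcoefD !gvalM iter_alongZ fconst_mul.
have /ordge1P -> : ordge 1 (iter m (falong v) (gval q' * gval h)).
  by apply/ordge_iter_along; rewrite addnC; apply: ordgeM.
by rewrite add0r.
Qed.

(** * Associated primes of principal ideals *)

(** By Weierstrass division, the ring of germs modulo h embeds in F[x] / (W),
    where W is the Weierstrass polynomial of h and F is the field of fractions of
    the germs constant along v. If r is the remainder of d, the annihilator of d
    becomes the ideal of W / gcd (W, r), which is not the unit ideal; P is the
    ideal of an irreducible factor pi of that polynomial. *)
Lemma exists_associated_prime h d : h != 0 -> d \notin zeros h ->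
  exists P, [/\ prime_ideal P, h \in P, principal_at P,
    forall a, a * d \in zeros h -> a \in P &
    forall Q, prime_ideal Q -> h \in Q -> {subset Q <= P} -> {subset P <= Q}].
Proof.
move=> h0 dh; have hu : h \isn't a GRing.unit.
  apply: contra dh => hu; apply/zerosP; exists (d * h^-1).
  by rewrite mulrVK.
have [m [v [i0 [m0 vi0 hm hv]]]] := regular_direction h0 hu.
have hlow j : (j < m)%N -> iter j (vapp (along v)) h 0%MM = 0.
  exact: ordge_iter_low.
have [W [sW [q0 WE] WM Wdvd]] := weierstrass_polynomial vi0 hv hlow.
have W0 : W != 0 by rewrite -size_poly_gt0 sW.
have q0u : q0 \is a GRing.unit.
  rewrite germ_unitE; apply: contra WM => /eqP E.
  by rewrite WE iter_along_unit // E mul0r.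
pose O := dconst v; pose E := @ev K n v i0.
have div a := weierstrass_division vi0 hv hlow a.
have [qd [r rm dE]] := div d.
have r0 : r != 0.
  apply: contra dh => /eqP r0; apply/zerosP; exists qd.
  by rewrite dE r0 rmorph0 addr0.
pose g := gcdp W r; pose w := W %/ g.
have gW : g %| W by apply: dvdp_gcdl.
have gr : g %| r by apply: dvdp_gcdr.
have g0 : g != 0 := dvdpN0 gW W0.
have wW : w %| W by apply: divp_dvd.
have w0 : w != 0 := dvdpN0 wW W0.
have w1 : (1 < size w)%N.
  rewrite ltnNge; apply/negP => w1.
  have := Pdiv.Idomain.divpK gW; rewrite -/w => /(congr1 (fun p : {poly O} => size p)).
  rewrite size_scale ?expf_neq0 ?lead_coef_eq0 // size_mul // sW.
  have : (size g <= m)%N by apply: leq_trans rm; apply: dvdp_leq.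
  have -> : size w = 1%N by apply/eqP; rewrite eqn_leq w1 size_poly_gt0.
  by rewrite add1n /= => + gm; rewrite gm ltnn.
have [pi pirr piw] := exists_irreducible_factor w1.
have piW : pi %| W := dvdp_trans piw wW.
have pi0 : pi != 0 := dvdpN0 piW W0.
have pi1 : (1 < size pi)%N by case: pirr.
pose P : {pred A} :=
  [pred a | `[< exists q p, a = q * h + E p /\ pi %| p >]].
(* As pi divides W, membership in P may be read off any polynomial representing
   a, not only off the remainder. *)
have PE a q p : a = q * h + E p -> (a \in P) = (pi %| p).
  move=> aE; apply/asboolP/idP => [[q' [p' [aE' pip']]]|pip]; last by exists q, p.
  have /Wdvd Wp : E (p - p') = (q' - q) * h.
    have e1 : E p = a - q * h by rewrite aE addrC addKr.
    have e2 : E p' = a - q' * h by rewrite aE' addrC addKr.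
    by rewrite /E evB -/E e1 e2; ring.
  by rewrite -(subrK p' p) dvdp_addl // (dvdp_trans piW).
have constP (c : O) : c != 0 -> dval c \notin P.
  move=> c0; rewrite (PE _ 0 c%:P) ?mul0r ?add0r /E ?evC //.
  rewrite gtNdvdp ?polyC_eq0 // size_polyC c0 //.
have Pprime : prime_ideal P.
  split; [split|].
  - by rewrite (PE _ 0 0) ?dvdp0 // mul0r /E rmorph0 addr0.
  - rewrite (PE _ 0 1) ?mul0r ?add0r /E ?rmorph1 // dvdp1.
    by move: pi1; rewrite ltnNge; apply: contra => /eqP ->.
  - move=> a b c bP cP; have [qa [pa _ aE]] := div a.
    have [qb [pb _ bE]] := div b; have [qc [pc _ cE]] := div c.
    move: bP cP; rewrite (PE _ _ _ bE) (PE _ _ _ cE) => bP cP.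
    rewrite (PE _ (qa * b + E pa * qb + qc) (pa * pb + pc)).
      by rewrite dvdp_addr // dvdp_mull.
    rewrite /E evD evM cE {1}aE {1}bE -/E.
    rewrite bE; ring.
  - move=> a b; have [qa [pa _ aE]] := div a; have [qb [pb _ bE]] := div b.
    rewrite (PE _ (qa * b + E pa * qb) (pa * pb)).
      by move/(irreducible_prime pirr); rewrite -(PE _ _ _ aE) -(PE _ _ _ bE).
    by rewrite /E evM bE aE -/E; ring.
have hP : h \in P.
  by rewrite (PE _ 1 0) ?dvdp0 // mul1r /E rmorph0 addr0.
have piP : E pi \in P by rewrite (PE _ 0 pi) // mul0r add0r.
exists P; split=> //.
- exists (E pi) => // a; have [q [p _ aE]] := div a.
  rewrite (PE _ _ _ aE) => /Pdiv.Idomain.dvdpP[[c s] /= c0 cE].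
  have /Pdiv.Idomain.dvdpP[[c' s'] /= c'0 c'E] := piW.
  exists (dval c * dval c' * q0).
    by do 2?apply: (primeMn Pprime); rewrite ?constP // unit_notin.
  exists (dval c * q * E s' + dval c' * q0 * E s).
  have e1 : dval c * E p = E s * E pi by rewrite -evZ cE evM.
  have e2 : dval c' * (q0 * h) = E s' * E pi by rewrite -WE -evZ c'E evM.
  transitivity (dval c * q * (dval c' * (q0 * h)) + dval c' * q0 * (dval c * E p)).
    by rewrite aE -/E; ring.
  by rewrite e1 e2; ring.
- move=> a /zerosP[b ab]; have [q [p _ aE]] := div a; rewrite (PE _ _ _ aE).
  have /Wdvd Wpr : E (p * r) = (b - q * qd * h - q * E r - E p * qd) * h.
    rewrite /E evM -/E !mulrBl -ab aE dE -/E; ring.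
  pose t := r %/ g; have cop : coprimep w t by rewrite coprimep_div_gcd ?W0.
  have /(dvdp_trans piw) // : w %| p.
  rewrite -(Gauss_dvdpl _ cop) -(dvdp_mul2r _ _ g0) -mulrA.
  rewrite (Pdiv.Idomain.divpK gW) (Pdiv.Idomain.divpK gr) dvdpZl ?expf_neq0 ?lead_coef_eq0 //.
  by rewrite -scalerAr dvdpZr ?expf_neq0 ?lead_coef_eq0.
- move=> Q Qprime hQ QP; have WQ : E W \in Q by rewrite /E WE primeMl.
  have constQ (c : O) : c != 0 -> dval c \notin Q.
    by move=> /constP; apply: contra => /QP.
  (* In Q, hence in P, a polynomial has the factor pi, which can be removed
     unless pi itself is in Q. *)
  have red s (p : {poly O}) : (size p <= s)%N -> p != 0 -> E p \in Q -> E pi \in Q.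
    elim: s p => [|s IH] p; first by rewrite leqn0 size_poly_eq0 => ->.
    move=> ps p0 pQ; have : E p \in P := QP _ pQ.
    rewrite (PE _ 0 p) ?mul0r ?add0r // => /Pdiv.Idomain.dvdpP[[c t] /= c0 cE].
    have tpi : E t * E pi \in Q by rewrite -evM -cE evZ primeMl.
    have t0 : t != 0.
      apply: contra p0 => /eqP t0; move/eqP: cE.
      by rewrite t0 mul0r -mul_polyC mulf_eq0 polyC_eq0 (negPf c0).
    have [tQ|tQ] := boolP (E t \in Q); last exact: (primeMP Qprime tpi tQ).
    apply: IH tQ => //; rewrite -ltnS; apply: leq_trans ps.
    rewrite -(size_scale p c0) cE size_mul // -subn1 ltn_subRL.
    by rewrite addnC ltn_add2l.
  have piQ : E pi \in Q := red _ _ (leqnn _) W0 WQ.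
  move=> a aP; have [q [p _ aE]] := div a.
  move: aP; rewrite (PE _ _ _ aE) => /Pdiv.Idomain.dvdpP[[c t] /= c0 cE].
  have pQ : E p \in Q.
    apply: (primeMP Qprime) (constQ c c0).
    by rewrite -evZ cE evM primeMl.
  by rewrite aE primeD // primeMl.
Qed.

End AssociatedPrimes.

(** * A Jacobian criterion for primes of height one *)

Section HeightOne.

Variables (K : numFieldType) (n : nat).
Local Notation B := (germ K n).
Implicit Types (a b c g r : B).

Variable q : {pred B}.
Hypothesis q_prime : prime_ideal q.

Lemma deriv_mem_mul i c u : u \in q -> gderiv i (c * u) \in q ->
  c \notin q -> gderiv i u \in q.
Proof.
move=> uq; rewrite gderivM => H cq; apply: (primeMP q_prime) cq.
by rewrite -[X in X \in q](addKr (gderiv i c * u)) addrC primeB // primeMl.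
Qed.

(** The hypothesis on minors says that the differentials of the elements of q
    are proportional modulo q, as they are on a hypersurface. Take b in q of
    least order and v such that b is regular along v; then D_v b is not in q. If
    c in q is constant along v, so are its derivatives, and the minors of b and c
    show that they are again in q; this cannot go on until one of them is a unit.
    So q contains no nonzero germ constant along v and induces a prime ideal of
    F[x], where F is the field of fractions of the germs constant along v. That
    ideal contains the Weierstrass polynomial W of b and, for any r in q, the
    remainder of r, hence their gcd; as the derivative of W is not in q, the
    cofactor of the gcd in W is not in q, and multiplying r by it gives a
    multiple of b. *)
Lemma jacobian_principal b0 : b0 != 0 -> b0 \in q ->
  (forall b c i j, b \in q -> c \in q ->
     gderiv i b * gderiv j c - gderiv j b * gderiv i c \in q) ->
  principal_at q.
Proof.
move=> b00 b0q minors.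
have ex : exists m, `[< exists b v, b \in q /\
    iter m (vapp (@along K n v)) b 0%MM != 0 >].
  have [m [v _ hv]] := exists_regular b00.
  by exists m; apply/asboolP; exists b0, v; rewrite val_iter_along.
case: (ex_minnP ex) => m /asboolP[b [v [bq bm]]] mmin.
have low a w j : a \in q -> (j < m)%N -> iter j (vapp (@along K n w)) a 0%MM = 0.
  move=> aq jm; apply/eqP; apply: contrapT => /negP am.
  have : (m <= j)%N by apply: mmin; apply/asboolP; exists a, w.
  by rewrite leqNgt jm.
case: m => [|m] in ex bm mmin low *.
  by have := bq; rewrite (negPf (unit_notin q_prime _)) // germ_unitE.
have [i0 vi0] := exists_coordinate (ltn0Sn m) bm.
pose D := vapp (@along K n v); pose O := dconst v; pose E := @ev K n v i0.
have minorsD c j : c \in q -> D b * gderiv j c - gderiv j b * D c \in q.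
  move=> cq; rewrite /D /vapp mulr_suml mulr_sumr -sumrB; apply: prime_sum => // i.
  rewrite -mulrA [X in _ - X]mulrCA -mulrBr; apply: primeMl => //.
  exact: minors.
have Dbq : D b \notin q.
  by apply: contra bm => Dbq; rewrite iterSr low.
have constq (c : O) : c != 0 -> dval c \notin q.
  move=> c0; apply/negP => cq.
  have [|||a [aq _]] := @deriv_stable_unit K n (fun a => a \in q /\ D a = 0) (dval c).
  - by apply: contra c0 => /eqP c0; apply/eqP/val_inj.
  - by split=> //; apply: D_dconst.
  - move=> a i [aq Da]; split; last by rewrite /D D_gderiv -/D Da raddf0.
    apply: (primeMP q_prime) Dbq.
    by have := minorsD a i aq; rewrite Da mulr0 subr0.
  - by move/(unit_notin q_prime); rewrite aq.
have bl j : (j < m.+1)%N -> iter j D b 0%MM = 0 by apply: low.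
have [W [sW [u0 WE] WM Wdvd]] := weierstrass_polynomial vi0 bm bl.
have W0 : W != 0 by rewrite -size_poly_gt0 sW.
have WQ : E W \in q by rewrite /E WE primeMl.
have W'q : E W^`() \notin q.
  by apply: contra WM => W'q; rewrite iterSr D_ev // low.
exists b => // r rq; have [t [p pm rE]] := weierstrass_division vi0 bm bl r.
have pq : E p \in q.
  by rewrite -[E p](addKr (t * b)) -rE addrC primeB // primeMl.
pose g := gcdp W p; pose w := W %/ g.
have gW : g %| W := dvdp_gcdl _ _.
have /Pdiv.Idomain.dvdpP[[c s] /= c0 cE] : g %| p := dvdp_gcdr _ _.
have gq : E g \in q.
  have [u] := Bezoutp W p; rewrite -/g => /eqpP[[c1 c2] /= /andP[c10 c20] cc].
  apply: (primeMP q_prime) (constq c2 c20).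
  by rewrite -evZ -cc evZ evD !evM primeMl // primeD // primeMl.
have wE := Pdiv.Idomain.divpK gW; set e := lead_coef g ^+ _ in wE.
have e0 : e != 0 by rewrite expf_neq0 // lead_coef_eq0 (dvdpN0 gW).
have wq : E w \notin q.
  apply: contra W'q => wq; apply: (primeMP q_prime) (constq e e0).
  rewrite -evZ -derivZ -wE derivM evD !evM.
  by apply: primeD => //; [apply: primeMl | apply: primeMr].
exists (E w * dval c); first by rewrite primeMn // constq.
exists (E w * dval c * t + E s * dval e * u0).
have e1 : dval c * E p = E s * E g by rewrite -evZ cE evM.
have e2 : E w * E g = dval e * (u0 * b) by rewrite -WE -evZ -wE evM.
transitivity (E w * dval c * (t * b) + E w * (dval c * E p)).
  by rewrite rE -/E; ring.
rewrite e1 [X in _ + X]mulrCA e2; ring.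
Qed.

Hypothesis q_principal : principal_at q.

(** If all derivatives of g were in q then, locally at q, the generator pi would
    divide g twice, because some derivative of pi is not in q. Then g / pi would
    be nilpotent modulo g. *)
Lemma reduced_smooth_point g : g != 0 -> g \in q ->
  radical (zeros g) =i zeros g -> exists i, gderiv i g \notin q.
Proof.
move=> g0 gq g_rad; case: q_principal => pi piq piP.
have smooth a : a != 0 -> a \in q -> exists2 b, b \in q &
    exists i, gderiv i b \notin q.
  move=> a0 aq; apply: contrapT => H.
  have [|b bq] := @deriv_stable_unit K n (fun a => a \in q) a a0 aq.
    move=> b i bq; apply: contrapT => /negP Db.
    by apply: H; exists b => //; exists i.
  by move/(unit_notin q_prime); rewrite bq.
have [b bq [i Db]] := smooth g g0 gq.
have Dpi : gderiv i pi \notin q.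
  apply: contra Db => Dpi; have [c cq [u cE]] := piP _ bq.
  apply: (deriv_mem_mul bq) cq.
  by rewrite cE gderivM primeD // primeMr.
apply: contrapT => H; have Dg : gderiv i g \in q.
  by apply: contrapT => /negP Dg; apply: H; exists i.
have [s sq [g1 E1]] := piP _ gq.
have g1q : g1 \in q.
  apply: (primeMP q_prime) Dpi.
  have : gderiv i (s * g) \in q by rewrite gderivM primeD // primeMl.
  rewrite E1 gderivM => H1.
  by rewrite -[_ * _](addrK (pi * gderiv i g1)) primeB // primeMr.
have [s' s'q [g2 E2]] := piP _ g1q.
(* Up to the factor (s * s')^2, which is not in q, this is g / pi. *)
pose x := s * s' * pi * g2.
have xE : x * pi = (s * s') ^+ 2 * g.
  transitivity (s * s' * (pi * (pi * g2))); first by rewrite /x; ring.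
  have -> : pi * (pi * g2) = s' * (s * g) by rewrite -E2 mulrCA -E1.
  by rewrite /x; ring.
have : x \in radical (zeros g).
  apply/asboolP; exists 2%N; apply/zerosP; exists ((s * s') ^+ 3 * g2).
  transitivity (x * pi * (s * s' * g2)); first by rewrite /x; ring.
  by rewrite xE; ring.
rewrite g_rad => /zerosP[c xc].
have : (s * s') ^+ 2 \in q.
  have -> : (s * s') ^+ 2 = c * pi.
    by apply: (mulIf g0); rewrite -xE xc mulrAC.
  exact: primeMl.
by move=> /(primeX q_prime); rewrite (negPf (primeMn q_prime sq s'q)).
Qed.

End HeightOne.

(** * Determinants over integral domains *)

Lemma scalar_product_size (R : idomainType) m n
    (X : 'M[R]_(m, n)) (Y : 'M[R]_(n, m)) a :
  a != 0 -> X *m Y = a%:M -> (m <= n)%N.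
Proof.
move=> a0 XY; pose t := @tofrac R.
have t0 : t a != 0 by rewrite tofrac_eq0.
have : map_mx t X *m map_mx t Y = (t a)%:M by rewrite -map_mxM XY map_scalar_mx.
move=> /(congr1 (fun A => \rank A)); rewrite -scalemx1 mxrank_scale_nz // mxrank1.
by move=> <-; apply: leq_trans (mxrankM_maxl _ _) (rank_leq_col _).
Qed.

(** Both sides are the determinant of the block matrix Z. *)
Lemma det_add1_mulC (R : comNzRingType) m n (X : 'M[R]_(m, n)) (Y : 'M[R]_(n, m)) :
  \det (1%:M + X *m Y) = \det (1%:M + Y *m X).
Proof.
pose L := block_mx 1%:M 0 Y 1%:M : 'M[R]_(m + n).
pose Z := block_mx 1%:M X (- Y) 1%:M : 'M[R]_(m + n).
have dL : \det L = 1 by rewrite det_lblock !det1 mulr1.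
have : \det (Z *m L) = \det (L *m Z) by rewrite !det_mulmx mulrC.
rewrite /Z /L !mulmx_block !mul1mx !mulmx1 !mul0mx !mulmx0 !addr0 !add0r.
rewrite addNr subrr !det_ublock !det1 mulr1 mul1r => ->.
by rewrite addrC.
Qed.

(** * Saito's criterion *)

Section Saito.

Variables (K : numFieldType) (n : nat).
Local Notation A := (germ K n).
Implicit Types (a b c d h p : A) (xi : 'rV[A]_n).

Lemma zerosD h a b : a \in zeros h -> b \in zeros h -> a + b \in zeros h.
Proof.
by move=> /zerosP[c ->] /zerosP[d ->]; apply/zerosP; exists (c + d); rewrite mulrDl.
Qed.

Lemma zerosMl h a b : b \in zeros h -> a * b \in zeros h.
Proof. by move=> /zerosP[c ->]; apply/zerosP; exists (a * c); rewrite mulrA. Qed.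

Lemma zeros_sum h (I : finType) (F : I -> A) :
  (forall i, F i \in zeros h) -> \sum_i F i \in zeros h.
Proof.
move=> Fh; elim/big_ind: _ => //; last exact: zerosD.
by apply/zerosP; exists 0; rewrite mul0r.
Qed.

Lemma zeros_mul h a : a * h \in zeros h.
Proof. by apply/zerosP; exists a. Qed.

Lemma mem_zeros h : h \in zeros h.
Proof. by apply/zerosP; exists 1; rewrite mul1r. Qed.

Lemma logarithmic_mul m (c : 'rV[A]_m) (S : 'M_(m, n)) h :
  (forall j, logarithmic h (row j S)) -> logarithmic h (c *m S).
Proof.
by move=> Sh; rewrite /logarithmic vapp_mul; apply: zeros_sum => j; apply/zerosMl/Sh.
Qed.

(** From xi (h) in (h) the Leibniz rule gives that f divides xi (f) * u. Hence h
    divides the square of xi (f) * u, and so xi (f) * u itself. *)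
Lemma logarithmic_factor h f u xi : h != 0 -> radical (zeros h) =i zeros h ->
  h = f * u -> logarithmic h xi -> logarithmic f xi.
Proof.
move=> h0 h_rad hE /zerosP[c]; rewrite {1}hE vappM => E.
have fu : vapp xi f * u = f * (c * u - vapp xi u).
  by apply: (addIr (f * vapp xi u)); rewrite E hE; ring.
have : vapp xi f * u \in radical (zeros h).
  apply/asboolP; exists 2%N; apply/zerosP.
  exists (vapp xi f * (c * u - vapp xi u)); rewrite expr2 {1}fu hE; ring.
rewrite h_rad => /zerosP[e eE]; apply/zerosP; exists e.
have u0 : u != 0 by apply: contra h0 => /eqP u0; rewrite hE u0 mulr0.
by apply: (mulIf u0); rewrite eE hE mulrA.
Qed.

Variable p : A.
Hypotheses (p0 : p != 0) (p_rad : radical (zeros p) =i zeros p).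

(** Otherwise all derivatives of p would lie in a prime associated to p,
    against reduced_smooth_point. *)
Lemma gradient_regular d : (forall i, d * gderiv i p \in zeros p) -> d \in zeros p.
Proof.
move=> H; apply: contrapT => /negP dp.
have [P [Pprime pP Pprinc Pann _]] := exists_associated_prime p0 dp.
have [i Di] := reduced_smooth_point Pprime Pprinc p0 pP p_rad.
by move: Di; rewrite Pann // mulrC.
Qed.

(** Cramer's rule for the system S * grad p = 0 modulo p. *)
Lemma det_logarithmic (S : 'M[A]_n) :
  (forall j, logarithmic p (row j S)) -> \det S \in zeros p.
Proof.
move=> Sp; apply: gradient_regular => i.
pose grad : 'cV[A]_n := \col_i gderiv i p.
have /choice[c cE] j : exists c, vapp (row j S) p = c * p by apply/zerosP/Sp.
have E : S *m grad = p *: \col_j c j.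
  apply/colP => j; rewrite !mxE [RHS]mulrC -cE /vapp.
  by apply: eq_bigr => l _; rewrite !mxE.
have : (\det S *: grad) i 0 = (p *: (\adj S *m \col_j c j)) i 0.
  by rewrite -mul_scalar_mx -mul_adj_mx -mulmxA E scalemxAr.
rewrite [X in X = _ -> _]mxE [grad i 0]mxE => ->.
by rewrite mxE mulrC zeros_mul.
Qed.

(** The coefficients of a logarithmic field xi on the rows of S are, by Cramer's
    rule, quotients by p of determinants of logarithmic fields. *)
Lemma saito_criterion (S : 'M[A]_n) u : u \is a GRing.unit ->
  (forall j, logarithmic p (row j S)) -> \det S = u * p ->
  free_submod (logarithmic p).
Proof.
move=> uu Sp detS; have u0 : u != 0 by apply: contraTneq uu => ->; rewrite unitr0.
have det0 : \det S != 0 by rewrite detS mulf_neq0.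
exists n, (fun j => row j S); split=> // xi xi_log.
pose T j := \matrix_(i < n) (if i == j then xi else row i S).
have /choice[e eE] j : exists e, (xi *m \adj S) 0 j = e * p.
  have -> : (xi *m \adj S) 0 j = \det (T j).
    rewrite mxE (expand_det_row _ j); apply: eq_bigr => i _.
    rewrite !mxE eqxx; congr (_ * _); rewrite /cofactor; congr (_ * \det _).
    apply/matrixP => x y; rewrite !mxE.
    by rewrite eq_sym (negPf (neq_lift _ _)) !mxE.
  apply/zerosP/det_logarithmic => i; rewrite rowK.
  by case: ifP.
exists (u^-1 *: \row_j e j).
have xiE : xi = (u^-1 *: \row_j e j) *m S.
  apply/rowP => j; apply: (mulfI (mulf_neq0 u0 p0)).
  have : (xi *m \adj S *m S) 0 j = (u * p) * xi 0 j.
    by rewrite -mulmxA mul_adj_mx detS mul_mx_scalar mxE.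
  move=> <-; rewrite -scalemxAl [in RHS]mxE [u * p]mulrC -mulrA mulVKr //.
  rewrite !mxE mulr_sumr; apply: eq_bigr => i _.
  by rewrite eE mxE mulrCA mulrA.
split=> [|c]; first by rewrite -mulmx_sum_row.
rewrite -mulmx_sum_row {1}xiE => E; apply/rowP => j; apply: (mulfI det0).
have : ((u^-1 *: \row_j e j) *m S *m \adj S) 0 j = (c *m S *m \adj S) 0 j.
  by rewrite E.
rewrite -!mulmxA mul_mx_adj !mul_mx_scalar.
by rewrite [X in X = _ -> _]mxE [X in _ = X -> _]mxE.
Qed.

(** The rows of Z are the logarithmic fields p d_i and, for j different from i,
    (d_i p) d_j - (d_j p) d_i. Where d_i p does not vanish, they form a basis. *)
Lemma det_hamiltonian i (Z : 'M[A]_n) :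
  (forall j k, Z j k = if j == i then (k == i)%:R * p
     else (k == j)%:R * gderiv i p - (k == i)%:R * gderiv j p) ->
  \det Z = p * gderiv i p ^+ n.-1.
Proof.
move=> ZE; rewrite (expand_det_row _ i) (bigD1 i) //= big1 => [|k ki]; last first.
  by rewrite ZE eqxx (negPf ki) !mul0r.
rewrite ZE !eqxx mul1r addr0 /cofactor addnn -signr_odd odd_double expr0 mul1r.
rewrite -det_scalar; congr (_ * \det _); apply/matrixP => j k.
rewrite !mxE ZE eq_sym (negPf (neq_lift _ _)) [lift i k == i]eq_sym.
rewrite (negPf (neq_lift _ _)) mul0r subr0 (inj_eq lift_inj) eq_sym.
by case: eqP; rewrite ?mul1r ?mul0r ?mulr1n ?mulr0n.
Qed.

(** By det_logarithmic, p divides det S. If the quotient e were not a unit, it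
    would lie in an associated prime P, which contains p because det S divides a
    power of p. At P some derivative d_i p does not vanish, so the fields of
    det_hamiltonian are a basis there, and det S divides their determinant,
    which vanishes to first order only, like p. *)
Lemma saito_basis : free_submod (logarithmic p) ->
  exists S : 'M[A]_n, [/\ forall j, logarithmic p (row j S),
    forall xi, logarithmic p xi -> exists c : 'rV[A]_n, xi = c *m S &
    exists2 u, u \is a GRing.unit & \det S = u * p].
Proof.
move=> [r [b [b_log b_basis]]]; pose S := \matrix_(j < r) b j.
have S_log j : logarithmic p (row j S) by rewrite rowK.
have span xi : logarithmic p xi -> exists c : 'rV[A]_r, xi = c *m S.
  move=> /b_basis[c [cE _]]; exists c; rewrite cE mulmx_sum_row.
  by apply: eq_bigr => j _; rewrite rowK.
have indep (c c' : 'rV_r) : c *m S = c' *m S -> c = c'.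
  move=> E; have /b_basis[e [_ eU]] := logarithmic_mul c S_log.
  transitivity e; first apply/esym; apply: eU.
    by rewrite mulmx_sum_row; apply: eq_bigr => j _; rewrite rowK.
  by rewrite E mulmx_sum_row; apply: eq_bigr => j _; rewrite rowK.
have /choice[T0 T0E] i : exists c : 'rV[A]_r, p *: delta_mx 0 i = c *m S :> 'rV_n.
  apply: span; apply/zerosP; rewrite /logarithmic /vapp.
  exists (gderiv i p); rewrite (bigD1 i) //= big1 ?addr0 => [|j ji].
    by rewrite !mxE !eqxx mulr1 mulrC.
  by rewrite !mxE eqxx /= (negPf ji) mulr0 mul0r.
pose T := \matrix_(i < n) T0 i.
have TS : T *m S = p%:M.
  apply/row_matrixP => i; rewrite row_mul rowK -T0E.
  by apply/rowP => j; rewrite !mxE eqxx eq_sym mulr_natr.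
have ST : S *m T = p%:M.
  apply/row_matrixP => j; apply: indep; rewrite row_mul -mulmxA TS.
  rewrite mul_mx_scalar; apply/rowP => k; rewrite !mxE (bigD1 j) //= big1.
    by rewrite !mxE eqxx mulr1n addr0.
  by move=> l lj; rewrite !mxE eq_sym (negPf lj) mulr0n mul0r.
have rn : r = n.
  apply/eqP; rewrite eqn_leq (scalar_product_size p0 ST).
  exact: (scalar_product_size p0 TS).
subst r; exists S; split=> //.
have /zerosP[e detS] := det_logarithmic S_log.
exists e => //; apply: contrapT => /negP eu.
have detTS : \det T * e * p = p ^+ n.
  by rewrite -mulrA -detS -det_mulmx TS det_scalar.
have pn : p ^+ n != 0 by rewrite expf_neq0.
have e0 : e != 0.
  by apply: contra pn => /eqP e0; rewrite -detTS e0 mulr0 mul0r.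
have ne1 : 1 \notin zeros e.
  by apply: contra eu => /zerosP[c ce]; apply/unitrP; exists c; rewrite [e * c]mulrC -ce.
have [P [Pprime eP Pprinc _ _]] := exists_associated_prime e0 ne1.
have pP : p \in P.
  by apply: (primeX Pprime (e := n)); rewrite -detTS primeMr // primeMl.
have [i Di] := reduced_smooth_point Pprime Pprinc p0 pP p_rad.
pose Z : 'M[A]_n := \matrix_(j, k) if j == i then (k == i)%:R * p
     else (k == j)%:R * gderiv i p - (k == i)%:R * gderiv j p.
have pick (a : 'I_n -> A) j : \sum_k (k == j)%:R * a k = a j.
  rewrite (bigD1 j) //= eqxx mul1r big1 ?addr0 // => k kj.
  by rewrite (negPf kj) mul0r.
have /choice[C0 C0E] j : exists c : 'rV[A]_n, row j Z = c *m S.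
  apply: span; rewrite /logarithmic /vapp.
  under eq_bigr do rewrite !mxE.
  case: (j == i) => /=.
    under eq_bigr do rewrite -mulrA.
    by rewrite pick mulrC zeros_mul.
  rewrite (eq_bigr (fun k => (k == j)%:R * (gderiv i p * gderiv k p)
    - (k == i)%:R * (gderiv j p * gderiv k p))); last first.
    by move=> k _; rewrite mulrBl !mulrA.
  rewrite sumrB (pick (fun k => gderiv i p * gderiv k p)).
  rewrite (pick (fun k => gderiv j p * gderiv k p)) mulrC subrr.
  by apply/zerosP; exists 0; rewrite mul0r.
have ZC : Z = (\matrix_j C0 j) *m S.
  by apply/row_matrixP => j; rewrite row_mul rowK C0E.
have : gderiv i p ^+ n.-1 \in P.
  have -> : gderiv i p ^+ n.-1 = \det (\matrix_j C0 j) * e.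
    apply: (mulfI p0); rewrite -(@det_hamiltonian i Z) => [|j k]; last by rewrite mxE.
    by rewrite ZC det_mulmx detS; ring.
  exact: primeMl.
by move=> /(primeX Pprime); rewrite (negPf Di).
Qed.

End Saito.

(** * The normal crossing divisor *)

Section NormalCrossing.

Variables (K : numFieldType) (k : nat).
Local Notation B := (germ K k).
Implicit Types (a b c g : B) (i j : 'I_k).

Lemma gX_neq0 i : gX K i != 0 :> B.
Proof.
apply/eqP => /(congr1 (gderiv i)); rewrite gderivX eqxx raddf0 => /eqP.
by rewrite oner_eq0.
Qed.

(** Division by a coordinate leaves as remainder a germ independent of it, and
    such germs form a domain. *)
Lemma gX_prime i a b : a * b \in zeros (gX K i) ->
  (a \in zeros (gX K i)) || (b \in zeros (gX K i)).
Proof.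
have e1 : gX K i (U_(i) *+ 1)%MM != 0 by rewrite mulm1n /= eqxx oner_eq0.
have e0 (l : nat) : (l < 1)%N -> gX K i (U_(i) *+ l)%MM = 0.
  by rewrite ltnS leqn0 => /eqP ->; rewrite mulm0n /= eq_sym mnm1_eq0.
have div x := coord_division e1 e0 x.
have [q [r [r0 aE]]] := div a; have [q' [r' [r'0 bE]]] := div b.
move: aE bE; rewrite !big_ord1 !expr0 !mulr1 => aE bE /zerosP[s sE].
have E : (s - (q * b + r ord0 * q')) * gX K i = r ord0 * r' ord0.
  by rewrite mulrBl -sE {1}aE mulrDl [b in r ord0 * b]bE; ring.
have s0 : s - (q * b + r ord0 * q') = 0.
  apply: (coord_division_unique (M := 1) e1 e0
    (r := fun _ => r ord0 * r' ord0)) => [j|].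
    by rewrite gderivM r0 r'0 mul0r mulr0 addr0.
  by rewrite big_ord1 expr0 mulr1.
move: E; rewrite s0 mul0r => /esym/eqP; rewrite mulf_eq0 => /orP[]/eqP rr.
  by rewrite aE rr addr0 zeros_mul.
by rewrite bE rr addr0 zeros_mul orbT.
Qed.

Lemma gX_coprime i j : i != j -> gX K i \notin zeros (gX K j : B).
Proof.
move=> ij; apply/negP => /zerosP[c /(congr1 (fun h => gderiv i h 0%MM))].
rewrite gderivX gderivM gderivX (negPf ij) mulr0 addr0 eqxx gcoefM0.
rewrite [X in _ * X]/= eq_sym mnm1_eq0 mulr0 fcoef1 eqxx => /eqP.
by rewrite oner_eq0.
Qed.

Lemma prod_gX_dvd c : (forall i, c \in zeros (gX K i)) ->
  c \in zeros (\prod_i gX K i).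
Proof.
move=> H; suff : forall s : seq 'I_k, uniq s -> c \in zeros (\prod_(i <- s) gX K i).
  by apply; apply: index_enum_uniq.
elim=> [|j s IH] /=; first by rewrite big_nil -[c]mulr1 zeros_mul.
move=> /andP[js /IH /zerosP[d cE]]; rewrite big_cons.
have : d * \prod_(i <- s) gX K i \in zeros (gX K j) by rewrite -cE.
move=> /gX_prime /orP[/zerosP[e dE]|].
  by apply/zerosP; exists e; rewrite cE dE mulrA.
move=> sj; exfalso; elim: s js sj {IH cE} => [|i s IH]; rewrite ?big_nil ?big_cons.
  move=> _ /zerosP[e /(congr1 (fun h : B => h 0%MM))]; rewrite gcoefM0.
  rewrite [X in _ * X]/= eq_sym mnm1_eq0 mulr0 fcoef1 eqxx => /eqP.
  by rewrite oner_eq0.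
rewrite inE negb_or => /andP[ji js] /gX_prime /orP[|/(IH js) //].
by apply/negP/gX_coprime; rewrite eq_sym.
Qed.

End NormalCrossing.

(** * Preimages *)

Section Preimage.

Variables (K : numFieldType) (n k : nat) (f : mapgerm K n k).
Local Notation A := (germ K n).
Local Notation B := (germ K k).

Lemma gpreim_zeros (Z : {pred B}) g : Z =i zeros g ->
  gpreim f Z =i radical (zeros (pull f g)).
Proof.
move=> ZE a; apply/asboolP/asboolP => -[e]; rewrite !inE => /asboolP H; exists e.
  case: H => r [c [h [hZ ->]]]; apply: zeros_sum => j; apply: zerosMl.
  have := hZ j; rewrite ZE => /zerosP[d ->].
  by rewrite -/(pull f _) pullM zeros_mul.
case: H => c ->; apply/asboolP; exists 1%N, (fun _ => c), (fun _ => g); split.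
  by move=> _; rewrite ZE mem_zeros.
by rewrite big_ord1.
Qed.

Lemma pull_nonunit i : f i \isn't a GRing.unit.
Proof. by rewrite germ_unitE mapcomp0 eqxx. Qed.

End Preimage.

Lemma radical_exp (K : numFieldType) (n : nat) (h a : germ K n) e :
  radical (zeros h) =i zeros h -> a ^+ e \in zeros h -> a \in zeros h.
Proof. by move=> <- H; apply/asboolP; exists e. Qed.

(** * Pulling back along a map with Euler fields *)

Section EulerLifts.

Variables (K : numFieldType) (n k : nat).
Local Notation A := (germ K n).
Local Notation B := (germ K k).

Variables (f : mapgerm K n k) (eps : 'I_k -> 'rV[A]_n).
Hypothesis f_neq0 : forall i, f i != 0.
Hypothesis eps_f : forall i j, vapp (eps j) (f i) = (i == j)%:R * f i.

(** The field eps i lifts the Euler field y_i d_i. *)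
Lemma eps_pull i (b : B) : vapp (eps i) (pull f b) = pull f (gderiv i b) * f i.
Proof.
rewrite vapp_pull (bigD1 i) //= eps_f eqxx mul1r big1 ?addr0 // => j ji.
by rewrite eps_f (negPf ji) mul0r mulr0.
Qed.

(** By eps_pull, the kernel of f^* is stable under derivation. *)
Lemma pull_neq0 (b : B) : b != 0 -> pull f b != 0.
Proof.
move=> b0; apply/eqP => fb0.
have [|c fc0 cu] := @deriv_stable_unit K k (fun c => pull f c = 0) b b0 fb0.
  move=> c i fc0; have := eps_pull i c; rewrite fc0 raddf0 => /esym/eqP.
  by rewrite mulf_eq0 (negPf (f_neq0 i)) orbF => /eqP.
by have := rmorph_unit (pull f) cu; rewrite /= fc0 unitr0.
Qed.

Variable g : B.
Hypotheses (g0 : g != 0) (g_rad : radical (zeros g) =i zeros g).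

(** Off the zeros of the f i the map f is a submersion, by eps_f, and there the
    preimage of the singular locus of g has codimension at least two. The
    contraction q of P satisfies the hypothesis of jacobian_principal: locally at
    P the pullbacks of b, c in q are multiples pi * u, pi * w, and the minors of their
    derivatives along the eps i vanish modulo pi. So q has height one and
    reduced_smooth_point applies. *)
Lemma smooth_pullback (P : {pred A}) : prime_ideal P -> principal_at P ->
  (forall i, f i \notin P) -> pull f g \in P ->
  exists i, pull f (gderiv i g) \notin P.
Proof.
move=> Pprime [pi piP pi_gen] fP gP.
pose q : {pred B} := [pred b | pull f b \in P].
have q_prime : prime_ideal q.
  split; [split|] => [||a b c|a b]; rewrite !inE ?pullD ?pullM.
  - by rewrite raddf0 prime0.
  - by rewrite pull1 prime1.
  - by move=> bq cq; rewrite primeD // primeMl.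
  - by case: Pprime => _ PP /PP.
have q_minors b c i j : b \in q -> c \in q ->
    gderiv i b * gderiv j c - gderiv j b * gderiv i c \in q.
  rewrite !inE => bq cq; have [s sP [u sE]] := pi_gen _ bq.
  have [t tP [w tE]] := pi_gen _ cq.
  have mod_pi x r y l : pull f x \in P -> r * pull f x = pi * y ->
      r * (pull f (gderiv l x) * f l) - vapp (eps l) pi * y \in P.
    move=> xP /(congr1 (vapp (eps l))); rewrite !vappM eps_pull => E.
    have -> : r * (pull f (gderiv l x) * f l) - vapp (eps l) pi * y
        = pi * vapp (eps l) y - vapp (eps l) r * pull f x.
      by apply/eqP; rewrite subr_eq addrAC eq_sym subr_eq addrC [X in _ == X]addrC E.
    by apply: (primeB Pprime); [apply: primeMr | apply: primeMl].
  have bi := mod_pi _ _ _ i bq sE; have bj := mod_pi _ _ _ j bq sE.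
  have ci := mod_pi _ _ _ i cq tE; have cj := mod_pi _ _ _ j cq tE.
  apply: (primeMP Pprime (a := s * t * (f i * f j))); last first.
    by do 2?[apply: primeMn => //].
  rewrite pullB !pullM.
  set xi := pull f (gderiv i b) in bi *; set xj := pull f (gderiv j b) in bj *.
  set yi := pull f (gderiv i c) in ci *; set yj := pull f (gderiv j c) in cj *.
  set ei := vapp (eps i) pi in bi ci; set ej := vapp (eps j) pi in bj cj.
  have -> : s * t * (f i * f j) * (xi * yj - xj * yi)
    = (s * (xi * f i) - ei * u) * (t * (yj * f j))
      + ei * u * (t * (yj * f j) - ej * w)
      - ((s * (xj * f j) - ej * u) * (t * (yi * f i))
         + ej * u * (t * (yi * f i) - ei * w)) by ring.
  by apply: (primeB Pprime); apply: (primeD Pprime);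
    [apply: primeMr | apply: primeMl | apply: primeMr | apply: primeMl].
have gq : g \in q by [].
have q_princ := jacobian_principal q_prime g0 gq q_minors.
by have [i Di] := reduced_smooth_point q_prime q_princ g0 gq g_rad; exists i.
Qed.

Variable h : A.
Hypothesis h_f : forall i, h \in zeros (f i).
Hypothesis no_comp :
  forall P, component P (radical (zeros (pull f g))) -> h \notin P.

Let G := pull f g.
Let G0 : G != 0. Proof. exact: pull_neq0. Qed.

(** An associated prime of G is minimal, that is, a component of the preimage of
    g; by hypothesis it does not contain h. *)
Lemma good_prime d : d \notin zeros G -> exists P, [/\ prime_ideal P,
  principal_at P, forall a, a * d \in zeros G -> a \in P, h \notin P &
  [/\ forall i, f i \notin P, G \in P & exists i, pull f (gderiv i g) \notin P]].
Proof.
move=> dG; have [P [Pprime GP Pprinc Pann Pmin]] := exists_associated_prime G0 dG.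
have hP : h \notin P.
  apply: no_comp; split=> // [a /asboolP[e /zerosP[c cE]]|Q Qprime QG].
    by apply: (primeX Pprime (e := e)); rewrite cE primeMl.
  apply: Pmin => //; apply: QG; apply/asboolP; exists 1%N.
  by rewrite -[_ ^+ _]mul1r zeros_mul.
have fP i : f i \notin P.
  by apply: contra hP => fP; have /zerosP[c ->] := h_f i; rewrite primeMl.
by exists P; do !split=> //; apply: smooth_pullback.
Qed.

Lemma pull_coprime d : h * d \in zeros G -> d \in zeros G.
Proof.
move=> hd; apply: contrapT => /negP /good_prime[P [_ _ Pann hP _]].
by move: hP; rewrite Pann.
Qed.

Lemma pull_coprime_f i d : f i * d \in zeros G -> d \in zeros G.
Proof.
move=> fd; apply: pull_coprime; have /zerosP[c ->] := h_f i.
by rewrite -mulrA zerosMl.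
Qed.

(** If x is not in (G) but its square is, then G is, locally at an associated
    prime P, divisible by pi^2, and the derivatives of G along the eps i lie
    in P. *)
Lemma pull_radical : radical (zeros G) =i zeros G.
Proof.
have sq x : x * x \in zeros G -> x \in zeros G.
  move=> xx; apply: contrapT => /negP xG.
  have [P [Pprime [pi piP pi_gen] Pann _ [fP GP [i Di]]]] := good_prime xG.
  have [c cP [u cE]] := pi_gen _ (Pann _ xx).
  have [e eP [w eE]] := pi_gen _ GP.
  have wP : w \in P.
    apply: (primeMP Pprime) cP; rewrite mulrC; apply: Pann.
    have -> : w * c * x = u * (pi * w) by rewrite -mulrA cE; ring.
    by rewrite -eE mulrA zeros_mul.
  case/negP: Di; apply: (primeMP Pprime) (fP i); rewrite mulrC -eps_pull -/G.
  apply: (primeMP Pprime) eP.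
  have -> : e * vapp (eps i) G = vapp (eps i) pi * w + pi * vapp (eps i) w
      - vapp (eps i) e * G by rewrite -vappM -eE vappM; ring.
  apply: (primeB Pprime); last exact: primeMl.
  by apply: (primeD Pprime); [apply: primeMl | apply: primeMr].
move=> a; apply/asboolP/idP => [[e]|aG]; last by exists 1%N.
case: e => [|e]; first by rewrite expr0 => H; rewrite -[a]mulr1 zerosMl.
elim: e => [//|e IH] H; apply: IH; apply: sq.
by rewrite -exprD addSnnS exprD zerosMl.
Qed.

Lemma pull_divisor_rad : h != 0 -> radical (zeros h) =i zeros h ->
  radical (zeros (h * G)) =i zeros (h * G).
Proof.
move=> h0 h_rad a; apply/asboolP/idP => [[e /zerosP[c cE]]|aG]; last by exists 1%N.
have ah : a \in zeros h.
  by apply: (radical_exp (e := e) h_rad); rewrite cE mulrCA mulrC zeros_mul.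
have aG : a \in zeros G.
  by apply: (radical_exp (e := e) pull_radical); rewrite cE mulrA zeros_mul.
have /zerosP[b bE] := ah; rewrite bE mulrC in aG.
by have /zerosP[d dE] := pull_coprime aG; apply/zerosP; exists d; rewrite bE dE; ring.
Qed.

(** Otherwise f i would be a zero divisor modulo G. *)
Lemma pull_gX_notdvd i : g \notin zeros (gX K i).
Proof.
apply/negP => /zerosP[c cE].
have GE : G = f i * pull f c by rewrite /G cE pullM pullX mulrC.
have : f i * pull f c \in zeros G by rewrite -GE mem_zeros.
move=> /pull_coprime_f/zerosP[d dE].
have c0 : pull f c != 0 by apply: contra G0 => /eqP c0; rewrite GE c0 mulr0.
have : d * f i = 1 by apply: (mulIf c0); rewrite mul1r -mulrA -GE -dE.
by move=> df; case/negP: (pull_nonunit f i); apply/unitrP; exists d; rewrite [f i * d]mulrC.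
Qed.

(** A common multiple of g and of a prime gX K i that does not divide g is a
    multiple of their product. *)
Lemma normal_crossing_union (a : B) :
  (a \in gunion (normal_crossing K k) (zeros g))
    = (a \in zeros (\prod_i gX K i * g)).
Proof.
apply/andP/idP => [[aY /zerosP[c cE]]|/zerosP[c ->]]; last first.
  by split; [rewrite mulrCA mulrC | rewrite mulrA]; rewrite zeros_mul.
suff /prod_gX_dvd/zerosP[d dE] : forall i, c \in zeros (gX K i).
  by apply/zerosP; exists d; rewrite cE dE mulrA.
move=> i; have : c * g \in zeros (gX K i).
  rewrite -cE; have /zerosP[d ->] := aY.
  by rewrite (bigD1 i) //= mulrCA mulrC zeros_mul.
by move=> /gX_prime; rewrite (negPf (pull_gX_notdvd i)) orbF.
Qed.

Hypotheses (h0 : h != 0) (h_rad : radical (zeros h) =i zeros h).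

(** A field tangent to all coordinate hyperplanes is a combination of the Euler
    fields y_i d_i, whose determinant y_1 ... y_k is thus a factor of det S. *)
Lemma euler_basis (p : B) : p != 0 -> radical (zeros p) =i zeros p ->
  zeros p =i zeros (\prod_i gX K i * g) -> free_submod (logarithmic p) ->
  exists L : 'M[B]_k, (exists2 u, u \is a GRing.unit & \det L = u * g) /\
    forall j, \sum_i L j i * gX K i * gderiv i g \in zeros g.
Proof.
move=> p0 p_rad pE /(saito_basis p0 p_rad)[S [S_log _ [u uu detS]]].
set Y := \prod_i gX K i in pE.
have /zerosP[t tE] : p \in zeros (Y * g) by rewrite -pE mem_zeros.
have /zerosP[t' tE'] : Y * g \in zeros p.
  by rewrite pE mem_zeros.
have tu : t \is a GRing.unit.
  apply/unitrP; exists t'; rewrite [t * t']mulrC; suff -> : t' * t = 1 by [].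
  by apply: (mulIf p0); rewrite mul1r [RHS]tE tE'; ring.
have S_X j i : S j i \in zeros (gX K i).
  have pX : p = gX K i * (t * (\prod_(l | l != i) gX K l * g)).
    by rewrite tE /Y (bigD1 i) //=; ring.
  have := logarithmic_factor p0 p_rad pX (S_log j).
  by rewrite /logarithmic vappX mxE.
have /choice[L0 L0E] (ji : 'I_k * 'I_k) : exists c, S ji.1 ji.2 = c * gX K ji.2.
  exact/zerosP/S_X.
pose L : 'M[B]_k := \matrix_(j, i) L0 (j, i).
have SL j i : S j i = L j i * gX K i by rewrite mxE (L0E (j, i)).
exists L; split; last first.
  move=> j; have pg : p = g * (t * Y) by rewrite tE; ring.
  have := logarithmic_factor p0 p_rad pg (S_log j).
  rewrite /logarithmic /vapp; under eq_bigr do rewrite mxE SL.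
  by [].
exists (u * t); first by rewrite unitrM uu tu.
have Y0 : Y != 0 by apply/prodf_neq0 => i _; apply: gX_neq0.
apply: (mulIf Y0); have SD : S = L *m diag_mx (\row_i gX K i).
  by apply/matrixP => j i; rewrite mul_mx_diag mxE SL !mxE.
have : \det S = \det L * Y.
  rewrite SD det_mulmx det_diag; congr (_ * _); apply: eq_bigr => i _.
  by rewrite mxE.
by rewrite detS tE => <-; ring.
Qed.

(** Let S be a basis of the fields tangent to h, L as in euler_basis and Phi
    the matrix with S_l (f j) = Phi l j * f j. Replacing the component
    Phi l of S_l along the Euler fields by Phi l * L gives fields tangent to h
    and to G, with determinant h * G up to a unit. *)
Lemma pullback_free (L : 'M[B]_k) u : u \is a GRing.unit -> \det L = u * g ->
  (forall j, \sum_i L j i * gX K i * gderiv i g \in zeros g) ->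
  (forall i, logarithmic h (eps i)) -> free_submod (logarithmic h) ->
  free_submod (logarithmic (h * G)).
Proof.
move=> uu detL L_log eps_log /(saito_basis h0 h_rad)[S [S_log S_span [w wu detS]]].
have /choice[C0 C0E] j : exists c : 'rV[A]_n, eps j = c *m S by apply: S_span.
pose C : 'M[A]_(k, n) := \matrix_j C0 j.
have S_f l j : vapp (row l S) (f j) \in zeros (f j).
  have /zerosP[c cE] := h_f j; rewrite mulrC in cE.
  exact: logarithmic_factor h0 h_rad cE (S_log l).
have /choice[P0 P0E] (lj : 'I_n * 'I_k) :
    exists c, vapp (row lj.1 S) (f lj.2) = c * f lj.2 by apply/zerosP/S_f.
pose Phi : 'M[A]_(n, k) := \matrix_(l, j) P0 (l, j).
have PhiE l j : vapp (row l S) (f j) = Phi l j * f j by rewrite mxE (P0E (l, j)).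
have CPhi : C *m Phi = 1%:M.
  apply/matrixP => j i; apply: (mulIf (f_neq0 i)).
  have -> : (1%:M : 'M[A]_k) j i * f i = vapp (eps j) (f i).
    by rewrite eps_f mxE eq_sym.
  rewrite C0E vapp_mul mxE mulr_suml; apply: eq_bigr => l _.
  by rewrite PhiE [C j l]mxE mulrA.
(* The matrix N replaces Phi by Phi * L; its determinant is that of L, because
   C * Phi = 1. *)
pose N := 1%:M + Phi *m ((map_mx (pull f) L - 1%:M) *m C).
have NPhi : N *m Phi = Phi *m map_mx (pull f) L.
  rewrite mulmxDl mul1mx -!mulmxA CPhi mulmx1 mulmxBr mulmx1.
  by rewrite addrC subrK.
have detN : \det N = pull f u * G.
  rewrite det_add1_mulC -mulmxA CPhi mulmx1 addrC subrK.
  by rewrite det_map_mx detL /= pullM.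
have N_log l : logarithmic h (row l (N *m S)).
  by rewrite row_mul; apply: logarithmic_mul.
have N_G l : vapp (row l (N *m S)) G \in zeros G.
  have /choice[c cE] j : exists c, \sum_i L j i * gX K i * gderiv i g = c * g.
    exact/zerosP/L_log.
  have Nf j : vapp (row l (N *m S)) (f j) = (Phi *m map_mx (pull f) L) l j * f j.
    rewrite row_mul vapp_mul -NPhi mxE mulr_suml; apply: eq_bigr => i _.
    by rewrite PhiE mxE mulrA.
  rewrite vapp_pull; under eq_bigr do rewrite Nf mxE mulr_suml mulr_sumr.
  rewrite exchange_big; apply: zeros_sum => i.
  have -> : \sum_j pull f (gderiv j g) * (Phi l i * map_mx (pull f) L i j * f j)
      = Phi l i * pull f (c i) * G.
    rewrite -mulrA -pullM -cE rmorph_sum mulr_sumr; apply: eq_bigr => j _ /=.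
    by rewrite !pullM pullX [map_mx _ _ _ _]mxE; ring.
  exact: zeros_mul.
apply: (@saito_criterion _ _ (h * G) _ _ (N *m S) (pull f u * w)).
- by rewrite mulf_neq0.
- exact: pull_divisor_rad.
- by rewrite unitrM wu andbT (rmorph_unit (pull f)).
- move=> l; rewrite /logarithmic vappM.
  have /zerosP[a aE] := N_log l; have /zerosP[b bE] := N_G l.
  by apply/zerosP; exists (a + b); rewrite aE bE; ring.
- by rewrite det_mulmx detN detS; ring.
Qed.

End EulerLifts.

Theorem theorem4p1 (R : realType) (n k : nat)
    (D : 'I_k -> {pred germ R[i] n}) (f : mapgerm R[i] n k)
    (eps : 'I_k -> 'rV[germ R[i] n]_n) (E : {pred germ R[i] k})
    (D_free : free_divisor (gbigunion D))
    (f_eq : forall i, reduced_equation (f i) (D i))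
    (eps_f : forall i j, vapp (eps j) (f i) = (i == j)%:R * f i)
    (E_hyp : hypersurface E)
    (NE_free : free_divisor (gunion (normal_crossing R[i] k) E))
    (no_comp : forall P, component P (gpreim f E) -> ~ lies_in P (gbigunion D)) :
  gpreim f (gunion (normal_crossing R[i] k) E)
    =i gunion (gbigunion D) (gpreim f E)
  /\ free_divisor (gpreim f (gunion (normal_crossing R[i] k) E)).
Proof.
have [g [g0 g_rad EE]] := E_hyp; have [h [h0 h_rad DE] h_free] := D_free.
have [p [p0 p_rad NE] p_free] := NE_free.
have f0 i : f i != 0 by case: (f_eq i).
have DiE i a : (a \in D i) = (a \in zeros (f i)) by case: (f_eq i).
have f_rad i : radical (zeros (f i)) =i zeros (f i) by case: (f_eq i).
have DP a : reflect (forall i, a \in zeros (f i)) (a \in gbigunion D).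
  by apply: (iffP forallP) => H i; have := H i; rewrite DiE.
have h_f i : h \in zeros (f i).
  by move: i; apply/DP; rewrite DE mem_zeros.
have gpE := gpreim_zeros f EE; have gpN := gpreim_zeros f NE.
have no_comp' P : component P (radical (zeros (pull f g))) -> h \notin P.
  move=> [Pprime ZP Pmin]; apply/negP => hP; apply: (no_comp P).
    split=> // [a|Q Qprime ZQ]; first by rewrite gpE; apply: ZP.
    by apply: Pmin => // a; rewrite -gpE; apply: ZQ.
  by move=> a; rewrite DE => /zerosP[c ->]; apply: primeMl.
have NEY a : (a \in zeros p) = (a \in zeros (\prod_i gX R[i] i * g)).
  transitivity ((a \in normal_crossing R[i] k) && (a \in E)); first by rewrite -NE.
  by rewrite EE -(normal_crossing_union f0 eps_f g0 g_rad h_f no_comp').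
have unionE a : (a \in gpreim f (gunion (normal_crossing R[i] k) E))
    = (a \in gunion (gbigunion D) (gpreim f E)).
  rewrite gpN; apply/asboolP/andP => [[e /zerosP[c cE]]|[/DP aD]]; last first.
    rewrite -[a \in mem (gpreim f E)]/(a \in gpreim f E) gpE => /asboolP[e ae].
    have /choice[b bE] i : exists b, a = b * f i by apply/zerosP.
    have ak : a ^+ k = \prod_i b i * \prod_i f i.
      rewrite -big_split /= -[in LHS](card_ord k) -prodr_const.
      by apply: eq_bigr => i _; apply: bE.
    exists (k + e)%N; have /zerosP[c cE] := ae.
    have /zerosP[d dE] : \prod_i gX R[i] i * g \in zeros p by rewrite NEY mem_zeros.
    have PE : \prod_i f i * pull f g = pull f d * pull f p.
      rewrite -pullM -dE pullM rmorph_prod; congr (_ * _).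
      by apply: eq_bigr => i _; rewrite /= pullX.
    apply/zerosP; exists (\prod_i b i * c * pull f d).
    rewrite -[in RHS]mulrA -PE exprD ak cE; ring.
  have /zerosP[t tE] : p \in zeros (\prod_i gX R[i] i * g) by rewrite -NEY mem_zeros.
  split; last first.
    rewrite -[a \in mem (gpreim f E)]/(a \in gpreim f E) gpE; apply/asboolP.
    by exists e; rewrite cE tE mulrA pullM mulrA zeros_mul.
  apply/DP => i; apply: (radical_exp (e := e) (f_rad i)).
  by rewrite cE tE (bigD1 i) //= !pullM pullX; apply/zerosMl/zerosMl/zerosP;
    exists (pull f (\prod_(j | j != i) gX R[i] j) * pull f g); ring.
split=> //; exists (h * pull f g).
  have G0 := pull_neq0 f0 eps_f g0.
  have hG_rad := pull_divisor_rad f0 eps_f g0 g_rad h_f no_comp' h0 h_rad.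
  split=> //; first by rewrite mulf_neq0.
  move=> a; rewrite unionE; apply/andP/idP => [[]|/zerosP[c ->]].
    rewrite -[a \in mem (gbigunion D)]/(a \in gbigunion D) DE => /zerosP[b ->].
    rewrite -[_ \in mem (gpreim f E)]/(_ \in gpreim f E) gpE.
    rewrite (pull_radical f0 eps_f g0 g_rad h_f no_comp') mulrC => H.
    have /zerosP[d ->] := pull_coprime f0 eps_f g0 g_rad h_f no_comp' H.
    by rewrite mulrCA zeros_mul.
  split.
    rewrite -[_ \in mem (gbigunion D)]/(_ \in gbigunion D) DE.
    by rewrite mulrCA mulrC zeros_mul.
  rewrite -[_ \in mem (gpreim f E)]/(_ \in gpreim f E) gpE.
  by rewrite (pull_radical f0 eps_f g0 g_rad h_f no_comp') mulrA zeros_mul.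
have [L [[u uu detL] L_log]] :=
  euler_basis p0 p_rad NEY p_free.
apply: (pullback_free f0 eps_f g0 g_rad h_f no_comp' h0 h_rad uu detL L_log) => //.
move=> i; rewrite /logarithmic -DE; apply/DP => j.
have /zerosP[c ->] := h_f j; rewrite vappM eps_f.
by apply: zerosD; do ?[apply: zeros_mul | apply: zerosMl].
Qed.
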